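(* There exist universal positive constants $L_0$, $q_0$, $c$, $c'$ such that, for any fixed $L\geq L_0$ and $q>q_0$, there exists $\kappa_L>0$ (depending only on $L$) such that the following holds. For any $\theta\in\mathbb{R}^n$ and any $(\kappa_L,q)$-high-energy change-point $\tau_k^*$ of $\theta$, the penalized least-squares estimator $\widehat\tau$ (with tuning parameters $L$, $q$) satisfies $$\mathbb{P}\left(d_{H,1}(\widehat\tau,\tau_k^* )\mathbf{1}_{\mathcal{A}_q}\geq c\,x\,\Delta_k^{-2}\right)\leq c'e^{-x}\qquad\forall x\geq1.$$
   Context: Model: $Y_i=\theta_i+\epsilon_i$, $i=1,\dots,n$, where $\epsilon_1,\dots,\epsilon_n$ are independent, mean-zero and satisfy $\mathbb{E}[e^{t\epsilon_i}]\leq e^{t^2/2}$ for all $t\in\mathbb{R}$. Any $\theta\in\mathbb{R}^n$ is uniquely described by integers $1=\tau_0^*<\tau_1^*<\dots<\tau_K^*<\tau_{K+1}^*=n+1$ ($0\le K\le n-1$) and reals $\mu_1,\dots,\mu_{K+1}$ with $\mu_k\neq\mu_{k+1}$ and $\theta_i=\mu_k$ for $\tau_{k-1}^*\leq i<\tau_k^*$; the change-points of $\theta$ are $\tau_1^*,\dots,\tau_K^*$ and $\Delta_k=\mu_{k+1}-\mu_k$. The change-point $\tau_k^*$ is $(\kappa,q)$-high-energy if $$|\Delta_k|\sqrt{\frac{(\tau^*_k-\tau^*_{k-1})(\tau^*_{k+1}-\tau^*_k)}{\tau^*_{k+1}-\tau^*_{k-1}}}>\kappa\sqrt{2\log\left(\frac{n(\tau^*_{k+1}-\tau^*_{k-1})}{(\tau^*_{k+1}-\tau^*_k)(\tau^*_k-\tau^*_{k-1})}\right)+q}.$$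 $\mathcal{T}_3$ is the set of integer triplets $t=(t_1,t_2,t_3)$ with $1\leq t_1<t_2<t_3\leq n+1$, $N(t)=\left[\frac{\sum_{i=t_2}^{t_3-1}\epsilon_i}{t_3-t_2}-\frac{\sum_{i=t_1}^{t_2-1}\epsilon_i}{t_2-t_1}\right]\sqrt{\frac{(t_2-t_1)(t_3-t_2)}{t_3-t_1}}$, and $\mathcal{A}_q=\left\{|N(t)|\leq2\sqrt{2\log\left(\frac{n(t_3-t_1)}{(t_3-t_2)(t_2-t_1)}\right)+q}\ \ \forall t\in\mathcal{T}_3\right\}$. A change-point vector is a (possibly empty) strictly increasing vector $\tau=(\tau_1,\dots,\tau_{|\tau|})$ of integers in $\{2,\dots,n\}$, with the convention $\tau_0=1$, $\tau_{|\tau|+1}=n+1$; $d_{H,1}(\tau,\tau')=\min_i|\tau_i-\tau'|$ ($+\infty$ if $\tau$ is empty). $\Pi_\tau$ is the orthogonal projection onto the vectors constant on each $\{\tau_i,\dots,\tau_{i+1}-1\}$, $i=0,\dots,|\tau|$. The penalized least-squares estimator $\widehat\tau$ is any minimizer over all change-point vectors of $$\mathrm{Cr}_0(Y,\tau)=\|Y-\Pi_\tau Y\|^2+L\left[q|\tau|+2\sum_{i=1}^{|\tau|+1}\log\left(\frac{n}{\tau_i-\tau_{i-1}}\right)\right].$$ On the complement of $\mathcal{A}_q$ the product $d_{H,1}(\widehat\tau,\tau_k^* )\mathbf{1}_{\mathcal{A}_q}$ is $0$. *)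

(* Defs.v *)
From HB Require Import structures.
From mathcomp Require Import all_boot all_order all_algebra.
From mathcomp Require Import all_classical all_reals all_analysis.
From mathcomp Require Import zify.

Set Implicit Arguments.
Unset Strict Implicit.
Unset Printing Implicit Defensive.

Import Order.TTheory GRing.Theory Num.Theory.
Local Open Scope ring_scope.

(* Positions are numbered 1, ..., n: the entry of v : 'rV_n at position j is
   v 0 i with i : 'I_n and i.+1 = j. *)

Definition is_cpv (n : nat) (s : seq nat) : bool :=
  sorted ltn s && all (fun t => (2 <= t <= n)%N) s.

(* tau_k for 0 <= k <= |s|+1, with tau_0 = 1 and tau_{|s|+1} = n+1. *)
Definition cp (n : nat) (s : seq nat) (k : nat) : nat := nth n.+1 (1%N :: s) k.

(* Segment {tau_k, ..., tau_{k+1} - 1}; i stands for position i.+1. *)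
Definition in_seg (n : nat) (s : seq nat) (k i : nat) : bool :=
  (cp n s k <= i.+1 < cp n s k.+1)%N.

Definition describes (R : realType) (n : nat) (theta : 'rV[R]_n)
    (s : seq nat) (mu : nat -> R) : Prop :=
  [/\ is_cpv n s,
      forall k, (1 <= k <= size s)%N -> mu k <> mu k.+1 &
      forall k (i : 'I_n), (1 <= k <= (size s).+1)%N ->
        in_seg n s k.-1 i -> theta 0 i = mu k].

Definition weight (R : realType) (t1 t2 t3 : nat) : R :=
  ((t2 - t1) * (t3 - t2))%:R / (t3 - t1)%:R.

Definition threshold (R : realType) (n : nat) (q : R) (t1 t2 t3 : nat) : R :=
  Num.sqrt (2 * ln ((n * (t3 - t1))%:R / ((t3 - t2) * (t2 - t1))%:R) + q).

Definition jump (R : realType) (mu : nat -> R) (k : nat) : R := mu k.+1 - mu k.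

Definition high_energy (R : realType) (n : nat) (kappa q : R)
    (s : seq nat) (mu : nat -> R) (k : nat) : Prop :=
  `|jump mu k| * Num.sqrt (weight R (cp n s k.-1) (cp n s k) (cp n s k.+1))
  > kappa * threshold n q (cp n s k.-1) (cp n s k) (cp n s k.+1).

Definition mean_on (R : realType) (n : nat) (v : 'rV[R]_n) (a b : nat) : R :=
  (\sum_(i < n | (a <= i.+1 < b)%N) v 0 i) / (b - a)%:R.

Definition cusum (R : realType) (n : nat) (e : 'rV[R]_n) (t1 t2 t3 : nat) : R :=
  (mean_on e t2 t3 - mean_on e t1 t2) * Num.sqrt (weight R t1 t2 t3).

Definition good_noise (R : realType) (n : nat) (q : R) (e : 'rV[R]_n) : Prop :=
  forall t1 t2 t3 : nat, (1 <= t1)%N -> (t1 < t2)%N -> (t2 < t3)%N ->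
    (t3 <= n.+1)%N -> `|cusum e t1 t2 t3| <= 2 * threshold n q t1 t2 t3.

(* The rows are the indicators of the segments, so the row space is the space
   of vectors that are constant on each segment (see seg_mxP). *)
Definition seg_mx (R : realType) (n : nat) (s : seq nat) :
    'M[R]_((size s).+1, n) :=
  \matrix_(k, i) (in_seg n s k i)%:R.

(* Projection onto the row space of seg_mx along its orthogonal complement. *)
Definition seg_proj (R : realType) (n : nat) (s : seq nat) (v : 'rV[R]_n) :
    'rV[R]_n :=
  v *m proj_mx <<seg_mx R n s>>%MS (kermx (seg_mx R n s)^T).

(* The library norm `|v| on 'rV_n is the maximum norm. *)
Definition sqnorm2 (R : realType) (n : nat) (v : 'rV[R]_n) : R :=
  \sum_(i < n) v 0 i ^+ 2.

Definition Cr0 (R : realType) (n : nat) (L q : R) (y : 'rV[R]_n)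
    (s : seq nat) : R :=
  sqnorm2 (y - seg_proj s y) +
  L * (q * (size s)%:R
       + 2 * \sum_(1 <= i < (size s).+2)
               ln (n%:R / (cp n s i - cp n s i.-1)%:R)).

Definition is_minimizer (R : realType) (n : nat) (L q : R) (y : 'rV[R]_n)
    (s : seq nat) : Prop :=
  is_cpv n s /\ forall s', is_cpv n s' -> Cr0 L q y s <= Cr0 L q y s'.

Definition dH1 (R : realType) (s : seq nat) (t : nat) : \bar R :=
  \big[Order.min/+oo%E]_(u <- s) `|u%:R - t%:R : R|%:E.

Definition mutually_independent (R : realType) (d : measure_display)
    (T : measurableType d) (P : probability T R) (n : nat)
    (X : 'I_n -> {RV P >-> R}) : Prop :=
  forall (J : {set 'I_n}) (B : 'I_n -> set R),
    (forall i, measurable (B i)) ->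
    P [set w | forall i, i \in J -> B i (X i w)]%classic =
    (\prod_(i in J) P (X i @^-1` B i)%classic)%E.

Definition subgaussian_noise (R : realType) (d : measure_display)
    (T : measurableType d) (P : probability T R) (n : nat)
    (eps : 'I_n -> {RV P >-> R}) : Prop :=
  [/\ mutually_independent eps,
      forall i, P.-integrable setT (EFin \o eps i),
      forall i, ('E_P[eps i] = 0)%E &
      forall i (t : R),
        ('E_P[fun w => expR (t * eps i w)] <= (expR (t ^+ 2 / 2))%:E)%E].

Definition noise_vec (R : realType) (d : measure_display)
    (T : measurableType d) (P : probability T R) (n : nat)
    (eps : 'I_n -> {RV P >-> R}) (w : T) : 'rV[R]_n :=
  \row_i eps i w.

Lemma cp_lt (n : nat) (s : seq nat) (k : nat) :
  (0 < n)%N -> is_cpv n s -> (k <= size s)%N -> (cp n s k < cp n s k.+1)%N.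
Proof.
move=> n_gt0 /andP[s_sorted /allP s_in] ks; rewrite /cp.
suff p : path ltn 1 (rcons s n.+1).
  have E j : nth n.+1 (rcons s n.+1) j = nth n.+1 s j.
    by rewrite nth_rcons; case: ltngtP => // sj; rewrite nth_default// ?sj// ltnW.
  have := pathP n.+1 p k; rewrite size_rcons ltnS => /(_ ks).
  by rewrite E; case: k {ks} => //= k; rewrite E.
rewrite rcons_path; apply/andP; split.
  by case: s s_sorted s_in {ks} => //= a l -> /(_ a (mem_head _ _)) /andP[->].
by have /predU1P[->|/s_in /andP[_]] := mem_last 1%N s.
Qed.

Lemma cp_le (n : nat) (s : seq nat) (j k : nat) : (0 < n)%N -> is_cpv n s ->
  (j <= k <= (size s).+1)%N -> (cp n s j <= cp n s k)%N.
Proof.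
move=> n_gt0 cs; elim: k => [|k IHk]; first by case: j.
case/andP; rewrite leq_eqVlt => /predU1P[->//|jk] ks.
have IH : (cp n s j <= cp n s k)%N by apply: IHk; lia.
exact: leq_trans IH (ltnW (cp_lt n_gt0 cs ks)).
Qed.

Lemma in_seg_inj (n : nat) (s : seq nat) (j k i : nat) : (0 < n)%N ->
  is_cpv n s -> (j <= size s)%N -> (k <= size s)%N ->
  in_seg n s j i -> in_seg n s k i -> j = k.
Proof.
move=> n_gt0 cs js ks /andP[ji ij] /andP[ki ik].
case: (ltngtP j k) => // jk.
  have := @cp_le n s j.+1 k n_gt0 cs; lia.
have := @cp_le n s k.+1 j n_gt0 cs; lia.
Qed.

Lemma in_seg_exists (n : nat) (s : seq nat) (i : 'I_n) :
  exists k : 'I_(size s).+1, in_seg n s k i.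
Proof.
have ex : exists k, (k <= (size s).+1)%N && (i.+1 < cp n s k)%N.
  by exists (size s).+1; rewrite leqnn /cp /= nth_default//= ltnS.
case: (ex_minnP ex) => -[|k] /andP[ks ik] kmin; first by move: ik; rewrite /cp.
exists (Ordinal ks); rewrite /in_seg /= ik andbT leqNgt; apply/negP => ki.
by have := kmin k; rewrite ki (ltnW ks) ltnn => /(_ isT).
Qed.

Lemma seg_mxP (R : realType) (n : nat) (s : seq nat) (v : 'rV[R]_n) :
  is_cpv n s ->
  (v <= seg_mx R n s)%MS <->
  (forall (k : nat) (i j : 'I_n), (k <= size s)%N ->
     in_seg n s k i -> in_seg n s k j -> v 0 i = v 0 j).
Proof.
move=> cs; have sumE (D : 'rV[R]_(size s).+1) (k : 'I_(size s).+1) (i : 'I_n) :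
    in_seg n s k i -> (D *m seg_mx R n s) 0 i = D 0 k.
  have n_gt0 : (0 < n)%N by case: i => ? /=; lia.
  move=> ki; rewrite !mxE (bigD1 k)//= mxE ki mulr1 big1 ?addr0// => l lk.
  rewrite mxE; have [li|] := boolP (in_seg n s l i); last by rewrite mulr0.
  case/eqP: lk; apply/val_inj.
  by apply: (in_seg_inj n_gt0 cs _ _ li ki); rewrite -ltnS.
split=> [/submxP[D ->] k i j ks ki kj|vC].
  have E := sumE D (Ordinal (ks : (k < (size s).+1)%N)).
  by rewrite (E _ ki) (E _ kj).
apply/submxP.
exists (\row_(k < (size s).+1)
   if [pick i : 'I_n | in_seg n s k i] is Some i then v 0 i else 0).
apply/rowP => i; have [k ki] := in_seg_exists s i.
rewrite (sumE _ k)// mxE; case: pickP => [j kj|/(_ i)]; last by rewrite ki.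
by apply: (vC k) => //; rewrite -ltnS.
Qed.

Lemma seg_projP (R : realType) (n : nat) (s : seq nat) (v : 'rV[R]_n) :
  (seg_proj s v <= seg_mx R n s)%MS /\
  forall u : 'rV[R]_n, (u <= seg_mx R n s)%MS ->
    \sum_(i < n) (v - seg_proj s v) 0 i * u 0 i = 0.
Proof.
set V := seg_mx R n s.
split; first by rewrite (submx_trans (proj_mx_sub _ _ _))// genmxE.
have dx : (<<V>> :&: kermx V^T)%MS = 0.
  apply/eqP; rewrite -submx0; apply/rV_subP => u; rewrite sub_capmx genmxE.
  case/andP=> /submxP[D uE] /sub_kermxP uV; rewrite submx0.
  have /rowP/(_ 0) : u *m u^T = 0 by rewrite {2}uE trmx_mul mulmxA uV mul0mx.
  rewrite !mxE => /eqP; rewrite psumr_eq0 => [|i _]; last by rewrite mxE sqr_ge0.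
  move/allP => u0; apply/eqP/rowP => i; rewrite mxE.
  by have := u0 i (mem_index_enum _); rewrite mxE mulf_eq0 orbb => /eqP.
have full : (v <= <<V>> + kermx V^T)%MS.
  apply: submx_full; rewrite /row_full mxrank_disjoint_sum//.
  by rewrite genmxE mxrank_ker mxrank_tr subnKC// rank_leq_col.
move=> u /submxP[D ->].
have /sub_kermxP z := proj_mx_compl_sub full.
have E : ((v - seg_proj s v) *m (D *m V)^T) 0 0 = 0.
  by rewrite trmx_mul mulmxA z mul0mx mxE.
rewrite -[RHS]E [RHS]mxE.
by apply: eq_bigr => i _; rewrite [(D *m V)^T _ _]mxE.
Qed.

(* Main.v *)
Require Import Defs.
From HB Require Import structures.
From mathcomp Require Import all_boot all_order all_algebra.
From mathcomp Require Import all_classical all_reals all_analysis.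
From mathcomp Require Import measurable_realfun zify ring lra.
Import Order.TTheory GRing.Theory Num.Theory.
Local Open Scope ring_scope.

Set Implicit Arguments.
Unset Strict Implicit.
Unset Printing Implicit Defensive.

(* Inserting t between adjacent points u < v of a change-point vector changes
   the criterion by exactly L * thr^2(u, t, v) - C^2(u, t, v), where C is the
   CUSUM statistic of Y, so a minimizer is controlled by comparing it with
   vectors obtained from a few insertions and deletions. Let tau be the
   high-energy change-point, M the distance to its nearest neighbour, u < tau < v
   the adjacent estimated points around it. On the good event:
   - if both u and v are at distance more than M / 20, inserting tau together
     with auxiliary points at distance of order M lowers the criterion;
   - otherwise, if u is the closest, no other estimated point lies between
     tau - M / 10 and u (it could be deleted), and moving u to tau, with the
     deletion of v when v is also close, lowers the criterion as soon as u is at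
     distance at least d0 = c x / Delta^2 and the means of the noise over the
     intervals starting or ending at tau and of length at least d0 are at most
     |Delta| / 40.
   The condition on these means fails with probability at most 4 exp(-x): this is a
   line-crossing event for the supermartingale exp(r S_k - k r^2 / 2) with
   r = |Delta| / 40, to which Ville's inequality applies without any union
   bound over k. *)

(** * Ville's inequality for sums of independent sub-Gaussian variables *)

Section MaximalInequality.
Local Open Scope classical_set_scope.
Context (R : realType) (d : measure_display) (T : measurableType d)
  (P : probability T R) (n : nat).

(* A pi-system generating the sigma-algebra of the X_i, i in J. *)
Definition boxes (X : 'I_n -> {RV P >-> R}) (J : {set 'I_n}) : set (set T) :=
  [set A | exists2 B : 'I_n -> set R, (forall i, measurable (B i)) &
     A = [set w | forall i, i \in J -> B i (X i w)]].

Lemma boxes_setI (X : 'I_n -> {RV P >-> R}) (J : {set 'I_n}) :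
  setI_closed (boxes X J).
Proof.
move=> _ _ [A mA ->] [B mB ->]; exists (fun i => A i `&` B i).
  by move=> i; exact: measurableI.
apply/seteqP; split=> w /=.
  by move=> [Aw Bw] i iJ; split; [exact: Aw|exact: Bw].
by move=> H; split=> i /H [].
Qed.

Lemma boxes_measurable (X : 'I_n -> {RV P >-> R}) (J : {set 'I_n}) :
  boxes X J `<=` measurable.
Proof.
move=> _ [B mB ->].
rewrite (_ : [set w | _] = \bigcap_(i in [set` J]) (X i @^-1` B i)) //.
apply: fin_bigcap_measurable => // i _.
by rewrite -[X in measurable X]setTI; exact: measurable_funP.
Qed.

(** Both sides are finite measures in [A]. On the pi-system [boxes X J] they agree by
    [mutually_independent] applied to [j |: J] and to [J], hence they agree on the generated
    sigma-algebra. *)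
Lemma boxes_indep (X : 'I_n -> {RV P >-> R}) (J : {set 'I_n}) (j : 'I_n)
    (A : set T) (C : set R) :
  mutually_independent X -> j \notin J -> <<s boxes X J >> A -> measurable C ->
  P (A `&` X j @^-1` C) = (P A * P (X j @^-1` C))%E.
Proof.
move=> indX jJ GA mC.
have mD : measurable (X j @^-1` C).
  by rewrite -[X in measurable X]setTI; exact: measurable_funP.
pose m1 := mrestr P mD.
have Dr : (0 <= fine (P (X j @^-1` C)))%R by exact: fine_ge0.
pose m2 : {measure set T -> \bar R} := mscale (NngNum Dr) P.
have DE : (fine (P (X j @^-1` C)))%:E = P (X j @^-1` C).
  by rewrite fineK// fin_num_measure.
have -> : P (A `&` X j @^-1` C) = m1 A by [].
rewrite muleC -DE -[RHS]/(m2 A).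
apply: (g_sigma_algebra_measure_unique (boxes X J) _ (fun _ => setT)) => //.
- exact: boxes_measurable.
- move=> _; exists (fun _ => setT) => //; apply/seteqP; split=> w //=.
- by rewrite bigcup_const//; exists 0%N.
- exact: boxes_setI.
- move=> _ [B mB ->]; rewrite /m1/= /mrestr /m2 /= /mscale /= DE.
  have mB' i : measurable ((fun i => if i == j then C else B i) i).
    by case: ifP.
  have := indX (j |: J) _ mB'; rewrite big_setU1//= eqxx => IH.
  rewrite (_ : _ `&` _ = [set w | forall i, i \in j |: J ->
      (if i == j then C else B i) (X i w)]).
    rewrite IH (indX J B mB); congr (_ * _)%E; apply: eq_bigr => i iJ.
    by case: eqP => // ij; rewrite -ij iJ in jJ.
  apply/seteqP; split=> w /=.
    move=> [Bw Cw] i; rewrite !inE; case: eqP => [->//|_ /=]; exact: Bw.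
  move=> H; split=> [i iJ|].
    have := H i; rewrite !inE iJ orbT => /(_ isT); case: eqP => // ij.
    by rewrite -ij iJ in jJ.
  by have := H j; rewrite !inE eqxx => /(_ isT).
- by move=> _; rewrite /= /mrestr setTI ltey_eq fin_num_measure.
Qed.

(** By [boxes_indep], the joint law of the past and of [X j] is the product of the two marginal
    laws; Tonelli's theorem then factorizes the integral. *)
Lemma expectation_boxes (X : 'I_n -> {RV P >-> R}) (J : {set 'I_n}) (j : 'I_n)
    (h : g_sigma_algebraType (boxes X J) -> R) (f : R -> R) :
  mutually_independent X -> j \notin J ->
  measurable_fun setT h -> measurable_fun setT f ->
  (forall a, 0 <= h a) -> (forall y, 0 <= f y) ->
  (\int[P]_w (h w * f (X j w))%:E =
   \int[P]_w (h w)%:E * \int[P]_w (f (X j w))%:E)%E.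
Proof.
move=> indX jJ mh mf h0 f0.
pose TG : measurableType _ := g_sigma_algebraType (boxes X J).
(* The identity, seen as a random variable with values in [T] equipped with the smaller
   sigma-algebra of the [X i], [i \in J]: its law carries all the information about the past. *)
pose id' : T -> TG := fun w => w.
have mid : measurable_fun setT id'.
  move=> _ A GA; rewrite setTI.
  by move: A GA; apply: smallest_sub; [exact: sigma_algebra_measurable|
     exact: boxes_measurable].
pose idM : {mfun T >-> TG} := mfun_Sub (mem_set mid : id' \in mfun).
pose Q1 := distribution P idM.
pose Q2 := distribution P (X j).
pose pr : T -> TG * R := fun w => (id' w, X j w).
have mpr : measurable_fun setT pr by exact: measurable_fun_pair.
pose prM : {mfun T >-> (TG * R)%type} := mfun_Sub (mem_set mpr : pr \in mfun).
pose Q := distribution P prM.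
have QE : forall S, measurable S -> (Q1 \x Q2)%E S = Q S.
  apply: product_measure_unique => A B mA mB.
  exact: (boxes_indep indX jJ mA mB).
pose F : (TG * R)%type -> R := fun z => h z.1 * f z.2.
have mF : measurable_fun setT F.
  apply: measurable_funM.
    exact: (measurableT_comp mh measurable_fst).
  exact: (measurableT_comp mf measurable_snd).
have F0 z : (0 <= (F z)%:E)%E by rewrite lee_fin mulr_ge0.
have mFE : measurable_fun setT (EFin \o F) by exact/measurable_EFinP.
transitivity (\int[Q]_z (F z)%:E)%E.
  by rewrite (ge0_integral_distribution prM mFE).
rewrite (eq_measure_integral (Q1 \x Q2)%E); last by move=> A mA _; exact: (esym (QE A mA)).
rewrite (fubini_tonelli1 _ mFE F0).
have m2 : measurable_fun setT (EFin \o f) by exact/measurable_EFinP.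
have m1 : measurable_fun setT (EFin \o h) by exact/measurable_EFinP.
transitivity (\int[Q1]_x ((h x)%:E * \int[Q2]_y (f y)%:E))%E.
  apply: eq_integral => x _; rewrite /fubini_F /F /=.
  rewrite -(ge0_integralZl _ measurableT m2) ?lee_fin//.
  by move=> y _; rewrite lee_fin.
rewrite /= ge0_integralZr//; last 2 first.
  - by move=> x _; rewrite lee_fin.
  - by apply: integral_ge0 => y _; rewrite lee_fin.
congr (_ * _)%E.
  by rewrite (ge0_integral_distribution idM m1)// => x; rewrite lee_fin.
by rewrite (ge0_integral_distribution (X j) m2)// => x; rewrite lee_fin.
Qed.

Lemma boxes_measurable_fun (X : 'I_n -> {RV P >-> R}) (J : {set 'I_n}) (j : 'I_n) :
  j \in J ->
  measurable_fun (setT : set (g_sigma_algebraType (boxes X J)))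
    (X j : g_sigma_algebraType (boxes X J) -> R).
Proof.
move=> jJ _ B mB; rewrite setTI; apply: sub_sigma_algebra.
exists (fun i => if i == j then B else setT) => [i|]; first by case: ifP.
apply/seteqP; split=> w /=; first by move=> Bw i _; case: eqP => // ->.
by move=> /(_ j jJ); rewrite eqxx.
Qed.

(* The supermartingale exp(t S_k - k t^2 / 2), frozen once it reaches a. *)
Fixpoint stopped_mart (X : 'I_n -> {RV P >-> R}) (t a : R) (s : nat -> 'I_n)
    (k : nat) (w : T) : R :=
  if k is k'.+1 then
    let z := stopped_mart X t a s k' w in
    if a <= z then z else z * expR (t * X (s k') w - t ^+ 2 / 2)
  else 1.

Lemma stopped_mart_ge0 (X : 'I_n -> {RV P >-> R}) t a s k w : 0 <= stopped_mart X t a s k w.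
Proof. by elim: k => [|k IH]//=; case: ifP => // _; rewrite mulr_ge0 ?expR_ge0. Qed.

(** Adaptedness: the value at time [k] depends on the first [k] variables only, which makes it
    independent of the next factor. *)
Lemma stopped_mart_boxes (X : 'I_n -> {RV P >-> R}) t a s k (J : {set 'I_n}) :
  (forall i, (i < k)%N -> s i \in J) ->
  measurable_fun (setT : set (g_sigma_algebraType (boxes X J)))
    (stopped_mart X t a s k : g_sigma_algebraType (boxes X J) -> R).
Proof.
elim: k => [|k IH] sJ /=; first exact: measurable_cst.
have mz := IH (fun i ik => sJ i (ltnW ik)).
apply: measurable_fun_ifT => //.
  by apply: measurable_fun_ler => //; exact: measurable_cst.
apply: measurable_funM => //.
apply: measurableT_comp => //; apply: measurable_funB; last exact: measurable_cst.
apply: measurable_funM; first exact: measurable_cst.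
by apply: boxes_measurable_fun; exact: sJ.
Qed.

Lemma stopped_mart_measurable (X : 'I_n -> {RV P >-> R}) t a s k :
  measurable_fun setT (stopped_mart X t a s k).
Proof.
elim: k => [|k IH] /=; first exact: measurable_cst.
apply: measurable_fun_ifT => //.
  by apply: measurable_fun_ler => //; exact: measurable_cst.
apply: measurable_funM => //.
apply: measurableT_comp => //; apply: measurable_funB; last exact: measurable_cst.
by apply: measurable_funM; first exact: measurable_cst.
Qed.

(** Induction on [k]. The value splits into the part [h'] already frozen, which does not change, and
    the part [h] still moving, which is multiplied by an independent factor of expectation at most 1
    by the sub-Gaussian bound. Injectivity of [s] keeps the new index out of the past. *)
Lemma stopped_mart_le1 (X : 'I_n -> {RV P >-> R}) t a s k :
  subgaussian_noise X ->
  (forall i j, (i < k)%N -> (j < k)%N -> s i = s j -> i = j) ->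
  (\int[P]_w (stopped_mart X t a s k w)%:E <= 1)%E.
Proof.
move=> [indX _ _ mgfX]; elim: k => [|k IH] sinj /=.
  by rewrite (@integral_cst _ _ _ P _ measurableT 1%E) mul1e probability_le1.
have {}IH := IH (fun i j ik jk => sinj i j (ltnW ik) (ltnW jk)).
apply: le_trans IH.
pose J := [set s i | i : 'I_k].
have sJ i : (i < k)%N -> s i \in J by move=> ik; apply/imsetP; exists (Ordinal ik).
have skJ : s k \notin J.
  apply/imsetP => -[i _ ski]; have := sinj k i (ltnSn k) (ltnW (ltn_ord i)) ski.
  by move=> ki; have := ltn_ord i; rewrite -ki ltnn.
pose z := stopped_mart X t a s k.
pose h w := if a <= z w then 0 else z w.
pose h' w := if a <= z w then z w else 0.
pose f y := expR (t * y - t ^+ 2 / 2).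
have mz : measurable_fun setT z by exact: stopped_mart_measurable.
have mzJ := stopped_mart_boxes (X := X) t a sJ.
have mh : measurable_fun setT (h : g_sigma_algebraType (boxes X J) -> R).
  apply: measurable_fun_ifT => //; apply: measurable_fun_ler => //.
have mhT : measurable_fun setT h.
  apply: measurable_fun_ifT => //; apply: measurable_fun_ler => //.
have mhT' : measurable_fun setT h'.
  apply: measurable_fun_ifT => //; apply: measurable_fun_ler => //.
have mf : measurable_fun setT f.
  apply: measurableT_comp => //; apply: measurable_funB; last exact: measurable_cst.
  by apply: measurable_funM => //; exact: measurable_cst.
have mfX : measurable_fun setT (fun w => f (X (s k) w)).
  exact: (measurableT_comp mf).
have z0 w : 0 <= z w by exact: stopped_mart_ge0.
have h0 w : 0 <= h w by rewrite /h; case: ifP.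
have h0' w : 0 <= h' w by rewrite /h'; case: ifP.
have f0 y : 0 <= f y by exact: expR_ge0.
have Ef : (\int[P]_w (f (X (s k) w))%:E <= 1)%E.
  have E0 : (0 <= expR (- (t ^+ 2 / 2)) :> R) by exact: expR_ge0.
  have mE : measurable_fun setT (EFin \o (fun w => expR (t * X (s k) w))).
    apply/measurable_EFinP; apply: measurableT_comp => //.
    by apply: measurable_funM => //; exact: measurable_cst.
  under eq_integral => w _ do rewrite /f expRD mulrC EFinM.
  rewrite (ge0_integralZl _ measurableT mE)//; last first.
    by move=> w _; rewrite lee_fin expR_ge0.
  have := mgfX (s k) t; rewrite unlock => H.
  apply: le_trans (lee_wpmul2l _ H) _; first by rewrite lee_fin.
  by rewrite -EFinM -expRD addNr expR0.
have -> : (\int[P]_w (if a <= z w then z w else z w * f (X (s k) w))%:E =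
    \int[P]_w (h' w)%:E + \int[P]_w (h w * f (X (s k) w))%:E)%E.
  rewrite -ge0_integralD//; first last.
  - by apply/measurable_EFinP; exact: measurable_funM.
  - by move=> w _; rewrite lee_fin mulr_ge0.
  - exact/measurable_EFinP.
  - by move=> w _; rewrite lee_fin.
  apply: eq_integral => w _; rewrite -EFinD /h /h'.
  by case: ifP => _; rewrite ?mul0r ?addr0 ?add0r.
have -> : (\int[P]_w (z w)%:E = \int[P]_w (h' w)%:E + \int[P]_w (h w)%:E)%E.
  rewrite -ge0_integralD//; first last.
  - exact/measurable_EFinP.
  - by move=> w _; rewrite lee_fin.
  - exact/measurable_EFinP.
  - by move=> w _; rewrite lee_fin.
  apply: eq_integral => w _; rewrite -EFinD /h /h'.
  by case: ifP => _; rewrite ?addr0 ?add0r.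
rewrite leeD2l//.
rewrite (expectation_boxes indX skJ mh mf h0 f0).
rewrite -[leRHS]mule1 lee_wpmul2l//.
by apply: integral_ge0 => w _; rewrite lee_fin.
Qed.

(** Either the stopped process reaches [a] at some time and keeps that value until [m], or it is
    never frozen and equals the exponential at all times, including [k], so that it reaches [a]
    after all. *)
Lemma stopped_mart_crossing (X : 'I_n -> {RV P >-> R}) (t a : R)
    (s : nat -> 'I_n) (k m : nat) (w : T) : (k <= m)%N ->
  a <= expR (t * \sum_(i < k) X (s i) w - k%:R * (t ^+ 2 / 2)) ->
  a <= stopped_mart X t a s m w.
Proof.
move=> km ka.
have stop j p : a <= stopped_mart X t a s j w ->
    a <= stopped_mart X t a s (j + p) w.
  by move=> aj; elim: p => [|p IH]; rewrite ?addn0// addnS /= IH.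
have [/existsP[j aj]|naj] := boolP [exists j : 'I_m.+1, a <= stopped_mart X t a s j w].
  have jm : (j <= m)%N by rewrite -ltnS.
  by rewrite -(subnKC jm) stop.
suff E j : (j <= m)%N -> stopped_mart X t a s j w =
    expR (t * \sum_(i < j) X (s i) w - j%:R * (t ^+ 2 / 2)).
  move/existsPn/(_ (Ordinal (km : k < m.+1)%N)) : naj.
  by rewrite /= E// ka.
elim: j => [_|j IH jm]; first by rewrite big_ord0 mul0r mulr0 subr0 expR0.
move/existsPn/(_ (Ordinal (leqW jm : j < m.+1)%N)) : naj => /= /negbTE -> .
rewrite (IH (ltnW jm)) -expRD big_ord_recr /=; congr expR; rewrite -natr1; ring.
Qed.

(** Markov's inequality for the stopped process at the single time [m]: by [stopped_mart_crossing],
    the event [A] covers a crossing at any [k <= m]. *)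
Lemma subgaussian_maximal (X : 'I_n -> {RV P >-> R}) (t l : R) (s : nat -> 'I_n)
    (m : nat) : subgaussian_noise X ->
  (forall i j, (i < m)%N -> (j < m)%N -> s i = s j -> i = j) ->
  exists A : set T, [/\ measurable A, (P A <= (expR (- l))%:E)%E &
    forall (k : nat) (w : T), (k <= m)%N ->
      l <= t * \sum_(i < k) X (s i) w - k%:R * (t ^+ 2 / 2) -> A w].
Proof.
move=> subX sinj; pose z := stopped_mart X t (expR l) s m.
have mz : measurable_fun setT z by exact: stopped_mart_measurable.
exists [set w | expR l <= z w]; split.
- by rewrite -[X in measurable X]setTI; exact: measurable_fun_le.
- have := @markov _ _ _ P (mfun_Sub (mem_set mz : z \in mfun)) id _ (expR_gt0 l)
    (@measurable_id _ _ _) (fun r r0 => r0) (fun x y _ _ xy => xy).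
  rewrite unlock /=; under eq_integral => w _ do
    rewrite /= ger0_norm ?stopped_mart_ge0//.
  move=> H; have {}H := le_trans H (stopped_mart_le1 _ _ subX sinj).
  rewrite expRN -[leRHS]mule1 lee_pdivlMl ?expR_gt0//.
  rewrite (_ : [set w | _] = [set x | (expR l)%:E <= `|(z x)%:E| ]%E)//.
  apply/seteqP; split=> w /=; rewrite lee_fin ger0_norm//; exact: stopped_mart_ge0.
- move=> k w km lk /=; apply: (stopped_mart_crossing km).
  by rewrite ler_expR.
Qed.

End MaximalInequality.

(** * The criterion as a sum over segments, and its change under an insertion *)

Section Criterion.
Context (R : realType).

Definition avg (F : R -> R) (a b : R) : R := (F b - F a) / (b - a).

(* The squared CUSUM statistic of a sample whose partial sums are given by F.
   Positions are real numbers, which makes the reflection z -> - z available. *)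
Definition cusum_sq (F : R -> R) (a t b : R) : R :=
  (avg F t b - avg F a t) ^+ 2 * ((t - a) * (b - t) / (b - a)).

Definition threshold_sq (n q a t b : R) : R :=
  q + 2 * ln (n * (b - a) / ((b - t) * (t - a))).

(** With the strict inequality, the increment between integers [a <= b] is the sum over the
    half-open segment of positions [a, ..., b - 1]. *)
Definition psum (n : nat) (y : 'rV[R]_n) (z : R) : R :=
  \sum_(i < n | i.+1%:R < z) y 0 i.

Lemma psumB n (y : 'rV[R]_n) (a b : nat) : (a <= b)%N ->
  \sum_(i < n | (a <= i.+1 < b)%N) y 0 i = psum y b%:R - psum y a%:R.
Proof.
move=> ab; rewrite /psum.
rewrite [X in _ = X - _](bigID (fun i : 'I_n => (i.+1 < a)%N)) /=.
rewrite [X in _ = X + _ - _](eq_bigl (fun i : 'I_n => i.+1%:R < a%:R :> R)); last first.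
  move=> i; rewrite !ltr_nat; lia.
rewrite [RHS]addrAC subrr add0r; apply: eq_bigl => i; rewrite ltr_nat; lia.
Qed.

Lemma mean_on_avg n (y : 'rV[R]_n) (a b : nat) : (a <= b)%N ->
  mean_on y a b = avg (psum y) a%:R b%:R.
Proof. by move=> ab; rewrite /mean_on /avg psumB// natrB. Qed.

(** Summing over consecutive points makes an insertion a local operation: only the gap that receives
    the new point changes. *)
Fixpoint pathsum (g : nat -> nat -> R) (N x : nat) (s : seq nat) : R :=
  if s is y :: s' then g x y + pathsum g N y s' else g x N.

Lemma pathsumE g N x s :
  pathsum g N x s =
  \sum_(0 <= k < (size s).+1) g (nth N (x :: s) k) (nth N (x :: s) k.+1).
Proof.
elim: s x => [|y s IH] x /=; first by rewrite big_nat1.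
by rewrite big_nat_recl//= IH.
Qed.

Lemma pathsum_insert g N x s1 t s2 :
  pathsum g N x (s1 ++ t :: s2) =
  pathsum g N x (s1 ++ s2) + g (last x s1) t + g t (head N s2)
    - g (last x s1) (head N s2).
Proof.
elim: s1 x => [|y s1 IH] x /=; last by rewrite IH !addrA.
by case: s2 => [|z s2] /=; ring.
Qed.

Lemma sum_segments n (s : seq nat) (f : 'I_n -> R) : is_cpv n s ->
  \sum_(i < n) f i = \sum_(0 <= k < (size s).+1) \sum_(i < n | in_seg n s k i) f i.
Proof.
move=> cs; rewrite big_mkord (exchange_big_dep predT) //=; apply: eq_bigr => i _.
have n0 : (0 < n)%N by case: i => ? /=; lia.
have [k ki] := in_seg_exists s i.
rewrite (big_pred1 k)// => j; rewrite /= -val_eqE; apply/idP/eqP => [ji|->//].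
by apply: (in_seg_inj n0 cs _ _ ji ki); rewrite -ltnS.
Qed.

Lemma card_segment n (a b : nat) : (1 <= a)%N -> (a <= b)%N -> (b <= n.+1)%N ->
  \sum_(i < n | (a <= i.+1 < b)%N) (1 : R) = (b - a)%:R.
Proof.
move=> a1 ab bn.
rewrite -(big_mkord (fun i => a <= i.+1 < b)%N (fun _ => 1 : R)) -big_filter.
rewrite (_ : [seq i <- index_iota 0 n | (a <= i.+1 < b)%N] = index_iota a.-1 b.-1).
  by rewrite big_const_seq count_predT size_iota iter_addr_0; congr (_%:R); lia.
apply: (@irr_sorted_eq _ ltn); [exact: ltn_trans|exact: ltnn| | |].
- by apply: sorted_filter; [exact: ltn_trans|exact: iota_ltn_sorted].
- exact: iota_ltn_sorted.
- by move=> i; rewrite mem_filter !mem_index_iota; lia.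
Qed.

(** The projection is constant on the segment, and orthogonality of the residual to the indicator of
    the segment forces this constant to be the mean of [y] there. *)
Lemma seg_projE n (s : seq nat) (y : 'rV[R]_n) (k : nat) (i : 'I_n) :
  is_cpv n s -> (k <= size s)%N -> in_seg n s k i ->
  seg_proj s y 0 i = avg (psum y) (cp n s k)%:R (cp n s k.+1)%:R.
Proof.
move=> cs ks ki; have n0 : (0 < n)%N by case: i {ki} => ? /=; lia.
have [pV orth] := seg_projP s y; have pC := (seg_mxP _ cs).1 pV.
move: {pV}(seg_proj s y) orth pC => p orth pC.
have lt := cp_lt n0 cs ks.
have a1 : (1 <= cp n s k)%N by apply: (@cp_le n s 0 k n0 cs); rewrite leqW.
have bn : (cp n s k.+1 <= n.+1)%N.
  have := @cp_le n s k.+1 (size s).+1 n0 cs; rewrite [cp n s (size s).+1]nth_default//.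
  by apply; rewrite leqnn andbT.
have := orth _ (row_sub (Ordinal (ks : (k < (size s).+1)%N)) (seg_mx R n s)).
under eq_bigr => j _ do rewrite !mxE /= mulr_natr mulrb.
rewrite -big_mkcond /= sumrB => /eqP; rewrite subr_eq0 => /eqP E.
apply/esym; rewrite -mean_on_avg 1?ltnW// /mean_on E.
rewrite (eq_bigr (fun _ => 1 * p 0 i)); last first.
  by move=> j kj; rewrite mul1r; exact: (pC k).
rewrite -mulr_suml card_segment// 1?ltnW// mulrAC mulfV ?mul1r// pnatr_eq0; lia.
Qed.

Lemma Cr0_pathsum n (L q : R) (y : 'rV[R]_n) (s : seq nat) : is_cpv n s ->
  Cr0 L q y s = \sum_(i < n) y 0 i ^+ 2 + L * q * (size s)%:R +
    pathsum (fun a b => L * 2 * ln (n%:R / (b - a)%:R)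
       - (psum y b%:R - psum y a%:R) ^+ 2 / (b%:R - a%:R)) n.+1 1 s.
Proof.
move=> cs; rewrite /Cr0 pathsumE sumrB -mulr_sumr.
have -> : sqnorm2 (y - seg_proj s y) = \sum_(i < n) y 0 i ^+ 2
   - \sum_(0 <= k < (size s).+1) (psum y (cp n s k.+1)%:R - psum y (cp n s k)%:R) ^+ 2
       / ((cp n s k.+1)%:R - (cp n s k)%:R).
  have [pV orth] := seg_projP s y.
  have pE := fun k i => @seg_projE n s y k i cs.
  move: (seg_proj s y) pV orth pE => p pV orth pE.
  rewrite /sqnorm2.
  have -> : \sum_(i < n) (y - p) 0 i ^+ 2 =
      \sum_(i < n) (y 0 i ^+ 2 - p 0 i * y 0 i).
    (* The added sum is zero, the residual being orthogonal to the projection. *)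
    transitivity (\sum_(i < n) (y - p) 0 i ^+ 2 + \sum_(i < n) (y - p) 0 i * p 0 i).
      by rewrite (orth _ pV) addr0.
    rewrite -big_split; apply: eq_bigr => i _ /=.
    rewrite !mxE; ring.
  rewrite sumrB; congr (_ - _).
  rewrite (sum_segments _ cs); apply: eq_big_nat => k /andP[_ ks].
  have lt : (0 < n)%N -> (cp n s k < cp n s k.+1)%N by move=> n0; exact: cp_lt.
  (* For [n = 0] the only segment is empty, with both ends equal to 1; its term is a quotient with
     numerator 0. *)
  have [n0|n0] := posnP n.
    have kC : cp n s k.+1 = cp n s k.
      move: cs => /andP[_]; case: (s) ks => [|a l]; last by rewrite n0 /=; case: a => [|[]].
      by rewrite ltnS leqn0 => /eqP -> _; rewrite /cp n0.
    rewrite kC subrr expr0n mul0r big1// => i; case: i => i im; exfalso; lia.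
  rewrite (eq_bigr (fun i => avg (psum y) (cp n s k)%:R (cp n s k.+1)%:R * y 0 i)).
    rewrite -mulr_sumr psumB 1?ltnW ?lt// /avg expr2; ring.
  by move=> i ki; rewrite (pE _ _ _ ki).
rewrite (big_addn 0 (size s).+2 1) subn1 /=.
under [X in 2 * X]eq_bigr => k _ do rewrite addn1.
rewrite /cp /=; ring.
Qed.

Lemma cpv_gap n s1 t s2 : is_cpv n (s1 ++ t :: s2) ->
  [/\ (1 <= last 1 s1)%N, (last 1 s1 < t)%N, (t < head n.+1 s2)%N &
     (head n.+1 s2 <= n.+1)%N].
Proof.
case/andP => ss /allP sn.
have st : sorted ltn (t :: s2).
  by apply: (subseq_sorted ltn_trans _ ss); exact: suffix_subseq.
have tn := sn t; rewrite mem_cat mem_head orbT in tn; have {}tn := tn isT.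
have sl : (1 <= last 1 s1 < t)%N.
  case/lastP: s1 ss sn => [|s1 u] ss sn; first by rewrite /=; lia.
  have := sn u; rewrite last_rcons mem_cat mem_rcons mem_head /= => /(_ isT).
  suff : (u < t)%N by lia.
  have : sorted ltn [:: u; t].
    apply: (subseq_sorted ltn_trans _ ss); rewrite -cats1 -catA.
    by apply: subseq_trans (suffix_subseq _ _); rewrite /= !eqxx; case: (s2).
  by rewrite /= andbT.
case/andP: sl => -> ->; split => //.
- case: (s2) st => [_|v l] /=; [lia|by case/andP].
- case: (s2) sn => [//|v l] sn /=.
  by have := sn v; rewrite mem_cat !inE eqxx !orbT => /(_ isT); lia.
Qed.

Lemma cpv_remove n s1 t s2 : is_cpv n (s1 ++ t :: s2) -> is_cpv n (s1 ++ s2).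
Proof.
have sub : subseq (s1 ++ s2) (s1 ++ t :: s2).
  by rewrite cat_subseq//; exact: subseq_cons.
case/andP => ss /allP sn; rewrite /is_cpv (subseq_sorted ltn_trans sub ss) /=.
by apply/allP => u /(mem_subseq sub) /sn.
Qed.

Lemma cpv_insert n s1 t s2 : is_cpv n (s1 ++ s2) -> (last 1 s1 < t)%N ->
  (t < head n.+1 s2)%N -> is_cpv n (s1 ++ t :: s2).
Proof.
case/andP => ss sn lt th; apply/andP; split; last first.
  move: sn; rewrite !all_cat /= => /andP[s1n s2n]; rewrite s1n s2n andbT /=.
  have : (head n.+1 s2 <= n.+1)%N.
    by case: (s2) s2n => //= v l /andP[vn _]; lia.
  have : (1 <= last 1 s1)%N.
    case/lastP: (s1) s1n => [//|l u]; rewrite all_rcons last_rcons; lia.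
  lia.
have : path ltn 1 (s1 ++ s2).
  case: (s1 ++ s2) ss sn => //= a l -> /andP[]; lia.
rewrite cat_path => /andP[p1 p2]; apply: (@path_sorted _ _ 1%N).
rewrite cat_path p1 /= lt; by case: (s2) p2 th => //= v l /andP[_ ->] ->.
Qed.

(** In the form of [Cr0_pathsum] only one gap changes: its three logarithms combine into the
    threshold, and its three squared increments into the squared CUSUM. *)
Lemma Cr0_insert n (L q : R) (y : 'rV[R]_n) (s1 s2 : seq nat) (t : nat) :
  is_cpv n (s1 ++ t :: s2) ->
  Cr0 L q y (s1 ++ t :: s2) = Cr0 L q y (s1 ++ s2)
    - cusum_sq (psum y) (last 1%N s1)%:R t%:R (head n.+1 s2)%:R
    + L * threshold_sq n%:R q (last 1%N s1)%:R t%:R (head n.+1 s2)%:R.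
Proof.
move=> cs; have cs' := cpv_remove cs; have [u1 ut tv vn] := cpv_gap cs.
rewrite !Cr0_pathsum// pathsum_insert !size_cat /= addnS -natr1.
set u := last _ _ in u1 ut *; set v := head _ _ in tv vn *.
rewrite /cusum_sq /threshold_sq /avg.
move: (psum y _) (psum y _) (psum y _) => Fu Fv Ft.
rewrite !natrB ?(ltnW ut, ltnW tv, ltnW (ltn_trans ut tv))//.
have n0 : (0 : R) < n%:R by rewrite ltr0n; lia.
have p0 : (0 : R) < t%:R - u%:R by rewrite subr_gt0 ltr_nat.
have r0 : (0 : R) < v%:R - t%:R by rewrite subr_gt0 ltr_nat.
move: (n%:R : R) (t%:R : R) (u%:R : R) (v%:R : R) n0 p0 r0 => N T U V n0 p0 r0.
have tr0 : 0 < V - U by lra.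
rewrite !ln_div ?posrE ?mulr_gt0// !lnM ?posrE//.
field.
by rewrite !gt_eqF//.
Qed.
End Criterion.

(** * Comparison of thresholds at different scales *)

Section Thresholds.
Context (R : realType).
Implicit Types (n q L a b t : R) (F W : R -> R).

(** The threshold up to a constant: [threshold_sq] lies between [level] and [level + 2] when [m] is
    the shorter of its two lengths. *)
Definition level (n q m : R) : R := q + 2 * ln (n / m).

Lemma ln_leB1 (x : R) : 0 < x -> ln x <= x - 1.
Proof.
by move=> x0; rewrite -ler_expR lnK ?posrE//; have := expR_ge1Dx (x - 1); lra.
Qed.

Lemma level_ge n q m : 0 < m <= n -> q <= level n q m.
Proof.
move=> /andP[m0 mn]; rewrite /level lerDl mulr_ge0// ln_ge0//.
by rewrite ler_pdivlMr ?mul1r.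
Qed.

Lemma level_le n q a b : 0 < n -> 0 < a <= b -> level n q b <= level n q a.
Proof.
move=> n0 /andP[a0 ab]; have b0 := lt_le_trans a0 ab.
rewrite /level lerD2l ler_pM2l// ler_ln ?posrE ?divr_gt0//.
by rewrite ler_pM2l// lef_pV2 ?posrE.
Qed.

Lemma threshold_sqE_r n q a t b : 0 < n -> a < t -> t < b ->
  threshold_sq n q a t b = level n q (b - t) + 2 * ln ((b - a) / (t - a)).
Proof.
move=> n0 at_ tb; have [t0 b0 ba] : [/\ 0 < t - a, 0 < b - t & 0 < b - a].
  by split; lra.
rewrite /threshold_sq /level -addrA -mulrDr -lnM ?posrE ?divr_gt0//.
by congr (_ + 2 * ln _); field; rewrite !gt_eqF.
Qed.

Lemma threshold_sqE_l n q a t b : 0 < n -> a < t -> t < b ->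
  threshold_sq n q a t b = level n q (t - a) + 2 * ln ((b - a) / (b - t)).
Proof.
move=> n0 at_ tb; have [t0 b0 ba] : [/\ 0 < t - a, 0 < b - t & 0 < b - a].
  by split; lra.
rewrite /threshold_sq /level -addrA -mulrDr -lnM ?posrE ?divr_gt0//.
by congr (_ + 2 * ln _); field; rewrite !gt_eqF.
Qed.

Lemma threshold_sq_ge_r n q a t b : 0 < n -> a < t -> t < b ->
  level n q (b - t) <= threshold_sq n q a t b.
Proof.
move=> n0 at_ tb; rewrite threshold_sqE_r// lerDl mulr_ge0// ln_ge0//.
by rewrite ler_pdivlMr; lra.
Qed.

Lemma threshold_sq_ge_l n q a t b : 0 < n -> a < t -> t < b ->
  level n q (t - a) <= threshold_sq n q a t b.
Proof.
move=> n0 at_ tb; rewrite threshold_sqE_l// lerDl mulr_ge0// ln_ge0//.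
by rewrite ler_pdivlMr; lra.
Qed.

(** The ratio [(b - a) / ((b - t) * (t - a))] is the sum of the inverses of the two lengths, hence
    at most [2 / g], and [ln 2 <= 1]. *)
Lemma threshold_sq_le n q a t b g : 0 < n -> 0 < g -> g <= t - a -> g <= b - t ->
  threshold_sq n q a t b <= level n q g + 2.
Proof.
move=> n0 g0 gt gb.
have [t0 b0 ba] : [/\ 0 < t - a, 0 < b - t & 0 < b - a] by split; lra.
have ln2 : ln (2 : R) <= 1 by have := @ln_leB1 2; lra.
suff : threshold_sq n q a t b <= level n q g + 2 * ln 2 by lra.
rewrite /threshold_sq /level -addrA lerD2l -mulrDr ler_pM2l//.
rewrite -lnM ?posrE ?divr_gt0// ler_ln ?posrE ?mulr_gt0 ?invr_gt0 ?mulr_gt0//.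
have -> : n * (b - a) / ((b - t) * (t - a)) = n * (1 / (t - a) + 1 / (b - t)).
  by field; rewrite !gt_eqF.
have i1 : 1 / (t - a) <= 1 / g by rewrite !div1r lef_pV2 ?posrE.
have i2 : 1 / (b - t) <= 1 / g by rewrite !div1r lef_pV2 ?posrE.
rewrite -mulrA ler_pM2l//; lra.
Qed.

(** The increase of penalty, up to the factor [L], when [u] is moved to [t]. Both thresholds contain
    the level at the common length [t - u], which cancels; the remaining logarithm of the second one
    is nonnegative, and that of the first is bounded by [ln_leB1]. *)
Lemma threshold_sq_sub n q u' u t v : 0 < n -> u' < u -> u < t -> t < v ->
  threshold_sq n q u t v - threshold_sq n q u' u t <= 2 * ((t - u) / (v - t)).
Proof.
move=> n0 u'u ut tv; have v0 : 0 < v - t by lra.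
rewrite (threshold_sqE_l _ n0 ut tv) (threshold_sqE_r _ n0 u'u ut).
have h1 : 0 <= ln ((t - u') / (u - u')).
  by apply: ln_ge0; rewrite ler_pdivlMr; lra.
have h2 : ln ((v - u) / (v - t)) <= (v - u) / (v - t) - 1.
  by apply: ln_leB1; rewrite divr_gt0//; lra.
have h3 : (v - u) / (v - t) - 1 = (t - u) / (v - t) by field; rewrite gt_eqF.
lra.
Qed.

(* With f = (m - o) / (t - o), the left-hand side is f * cusum_sq F o m t, and
   the term f * ln (1 / f) coming from the threshold is at most 1. *)
Lemma avg_noinsertion F n q L o m t : 0 < n -> 0 <= L -> 0 <= q ->
  o < m -> m < t -> t - m <= n -> cusum_sq F o m t <= L * threshold_sq n q o m t ->
  (avg F o t - avg F m t) ^+ 2 * (t - m) <= L * (level n q (t - m) + 2).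
Proof.
move=> n0 L0 q0 om mt tn hc.
have [p r s] : [/\ 0 < m - o, 0 < t - m & 0 < t - o] by split; lra.
pose f := (m - o) / (t - o).
have f0 : 0 < f by exact: divr_gt0.
have f1 : f <= 1 by rewrite ler_pdivrMr//; lra.
have -> : (avg F o t - avg F m t) ^+ 2 * (t - m) = f * cusum_sq F o m t.
  by rewrite /cusum_sq /avg /f; field; rewrite !gt_eqF.
have La : 0 <= level n q (t - m) by apply: le_trans (level_ge _ _); lra.
have lf : ln ((t - o) / (m - o)) <= f^-1 - 1.
  by rewrite invf_div; apply: ln_leB1; exact: divr_gt0.
have flf : f * ln ((t - o) / (m - o)) <= 1.
  by apply: le_trans (ler_wpM2l (ltW f0) lf) _; rewrite mulrBr divff ?gt_eqF//; lra.
apply: le_trans (ler_wpM2l (ltW f0) hc) _.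
rewrite threshold_sqE_r// mulrCA ler_wpM2l// mulrDr lerD//; last by rewrite mulrCA; lra.
by rewrite -[leRHS]mul1r ler_wpM2r.
Qed.

End Thresholds.

(** * Deterministic energy comparisons near a single change-point *)

Section Local.
Context (R : realType).
Implicit Types (n q L tau M mu a t b : R) (F W : R -> R) (G : R -> Prop).

(** [F] and [W] stand for the partial sums of the observations and of the noise. [G] selects the
    admissible positions; it is an arbitrary predicate because reflection sends the positions to
    negative numbers. *)
Definition homog_left G F W tau M mu := forall z, G z -> tau - M <= z <= tau ->
  F tau - F z = mu * (tau - z) + (W tau - W z).

Definition homog_right G F W tau M mu := forall z, G z -> tau <= z <= tau + M ->
  F z - F tau = mu * (z - tau) + (W z - W tau).

(** The factor 4 is the square of the factor 2 in [good_noise]. *)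
Definition small_noise G W n q lo hi := forall a t b, G a -> G t -> G b ->
  lo <= a -> a < t -> t < b -> b <= hi -> cusum_sq W a t b <= 4 * threshold_sq n q a t b.

Definition no_insertion F n q L a t b := a < t -> t < b ->
  cusum_sq F a t b <= L * threshold_sq n q a t b.

Lemma avg_homog_left G F W tau M mu a b : homog_left G F W tau M mu ->
  G a -> G b -> tau - M <= a -> a < b -> b <= tau -> avg F a b = mu + avg W a b.
Proof.
move=> hF Ga Gb Ma ab bt.
have := hF a Ga; have := hF b Gb.
have -> : tau - M <= a <= tau by lra.
have -> : tau - M <= b <= tau by lra.
move=> /(_ isT) hb /(_ isT) ha.
have -> : avg F a b = (mu * (b - a) + (W b - W a)) / (b - a).
  by rewrite /avg; congr (_ / _); lra.
by rewrite mulrDl mulfK// gt_eqF//; lra.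
Qed.

Lemma avg_homog_right G F W tau M mu a b : homog_right G F W tau M mu ->
  G a -> G b -> tau <= a -> a < b -> b <= tau + M -> avg F a b = mu + avg W a b.
Proof.
move=> hF Ga Gb Ma ab bt.
have := hF a Ga; have := hF b Gb.
have -> : tau <= a <= tau + M by lra.
have -> : tau <= b <= tau + M by lra.
move=> /(_ isT) hb /(_ isT) ha.
have -> : avg F a b = (mu * (b - a) + (W b - W a)) / (b - a).
  by rewrite /avg; congr (_ / _); lra.
by rewrite mulrDl mulfK// gt_eqF//; lra.
Qed.

(* The signal that may sit before tau - M is controlled because tau - M was not
   inserted between o and t. *)
Lemma removal_left G F W n q L tau M mu o t i :
  0 < M <= n -> 2 <= q -> 100 <= L ->
  G (tau - M) -> G o -> G t -> G i -> homog_left G F W tau M mu ->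
  small_noise G W n q (tau - M) tau ->
  o < t -> t < i -> i <= tau -> 10 * (tau - t) <= M ->
  no_insertion F n q L o (tau - M) t ->
  cusum_sq F o t i <= 3 / 4 * L * threshold_sq n q o t i.
Proof.
move=> /andP[M0 Mn] q2 L1 GM Go Gt Gi hF hW ot ti itau tM noin.
have n0 : 0 < n by lra.
have thq : q <= threshold_sq n q o t i.
  apply: le_trans (threshold_sq_ge_r q n0 ot ti); apply: level_ge; lra.
have Lth : 100 * threshold_sq n q o t i <= L * threshold_sq n q o t i by rewrite ler_pM2r; lra.
have hom a b := @avg_homog_left G F W tau M mu a b hF.
have [oM|Mo] := leP (tau - M) o.
  have := hW o t i Go Gt Gi oM ot ti itau.
  have -> : cusum_sq W o t i = cusum_sq F o t i.
    by rewrite /cusum_sq !hom//; [congr (_ ^+ 2 * _); ring| lra| lra].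
  lra.
set g := i - t; have g0 : 0 < g by rewrite /g; lra.
set m := tau - M in GM hW noin Mo *.
have mt : m < t by rewrite /m; lra.
have gm : 9 * g <= t - m by rewrite /g /m; lra.
have hA := hW m t i GM Gt Gi (lexx _) mt ti itau.
have Lamg : level n q g <= threshold_sq n q o t i by exact: threshold_sq_ge_r.
have gn : 0 < g <= n by rewrite /g; lra.
have thm : threshold_sq n q m t i <= level n q g + 2 by apply: threshold_sq_le => //; lra.
have hB : (avg F o t - avg F m t) ^+ 2 * (t - m) <= L * (level n q (t - m) + 2).
  apply: avg_noinsertion; rewrite ?(noin Mo mt)//; rewrite /m; lra.
have LM : level n q (t - m) <= level n q g by apply: level_le => //; lra.
(* [A] is a pure noise contrast on a homogeneous window; [B] is the error made by starting at [o]
   instead of [m = tau - M], controlled since [m] was not inserted. *)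
set A := avg W t i - avg W m t in hA.
set B := avg F o t - avg F m t in hB.
have E : avg F t i - avg F o t = A - B.
  rewrite /A /B (hom t i)// ?(hom m t)//; rewrite /m; lra.
have hAg : A ^+ 2 * g <= 9 * threshold_sq n q o t i.
  have wA : (t - m) * g / (i - m) >= g * (9 / 10).
    rewrite ler_pdivlMr; last by rewrite /g in gm g0 *; lra.
    have : (i - m) * 9 <= 10 * (t - m) by rewrite /g in gm *; lra.
    move=> h; have := ler_wpM2l (ltW g0) h; lra.
  have := ler_wpM2l (sqr_ge0 A) wA; move: hA; rewrite /cusum_sq -/A -/g.
  lra.
have hBg : B ^+ 2 * g <= 2 / 9 * (L * threshold_sq n q o t i).
  have h1 := ler_wpM2l (sqr_ge0 B) gm.
  have h2 : L * (level n q (t - m) + 2) <= L * (2 * threshold_sq n q o t i).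
    rewrite ler_pM2l; lra.
  lra.
(* With [100 <= L], the two terms contribute at most 18/100 and 4/9 of [L] times the threshold, in
   total less than 3/4. *)
have hD : (A - B) ^+ 2 * g <= 2 * (A ^+ 2 * g) + 2 * (B ^+ 2 * g).
  rewrite !mulrA -mulrDl ler_wpM2r ?(ltW g0)//.
  have := sqr_ge0 (A + B); lra.
have wg : (t - o) * g / (i - o) <= g.
  rewrite ler_pdivrMr; last by lra.
  rewrite mulrC ler_pM2l//; lra.
have := ler_wpM2l (sqr_ge0 (A - B)) wg.
rewrite /cusum_sq E -/g; lra.
Qed.

(* Exchanges the two sides of tau. *)
Definition refl (F : R -> R) (z : R) : R := - F (- z).

Lemma avg_refl F a b : avg (refl F) (- b) (- a) = avg F a b.
Proof. by rewrite /avg /refl !opprK; congr (_ / _); ring. Qed.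

Lemma cusum_sq_refl F a t b : cusum_sq (refl F) (- b) (- t) (- a) = cusum_sq F a t b.
Proof.
rewrite /cusum_sq !avg_refl -(opprB (avg F t b)) sqrrN; congr (_ * (_ / _)); ring.
Qed.

Lemma threshold_sq_refl n q a t b : threshold_sq n q (- b) (- t) (- a) = threshold_sq n q a t b.
Proof. by rewrite /threshold_sq; congr (_ + 2 * ln (_ * _ / _)); ring. Qed.

Lemma homog_refl_l G F W tau M mu : homog_right G F W tau M mu ->
  homog_left (fun z => G (- z)) (refl F) (refl W) (- tau) M mu.
Proof.
move=> h z Gz zM; have := h (- z) Gz.
have -> : tau <= - z <= tau + M by lra.
by rewrite /refl !opprK => /(_ isT); lra.
Qed.

Lemma homog_refl_r G F W tau M mu : homog_left G F W tau M mu ->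
  homog_right (fun z => G (- z)) (refl F) (refl W) (- tau) M mu.
Proof.
move=> h z Gz zM; have := h (- z) Gz.
have -> : tau - M <= - z <= tau by lra.
by rewrite /refl !opprK => /(_ isT); lra.
Qed.

Lemma small_noise_refl G W n q lo hi : small_noise G W n q lo hi ->
  small_noise (fun z => G (- z)) (refl W) n q (- hi) (- lo).
Proof.
move=> h a t b Ga Gt Gb ha at_ tb bh.
rewrite -[a]opprK -[t]opprK -[b]opprK cusum_sq_refl threshold_sq_refl.
apply: h => //; lra.
Qed.

Lemma no_insertion_refl F n q L a t b : no_insertion F n q L a t b ->
  no_insertion (refl F) n q L (- b) (- t) (- a).
Proof. move=> h ba ta; rewrite cusum_sq_refl threshold_sq_refl; apply: h; lra. Qed.

Lemma removal_right G F W n q L tau M mu i t o :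
  0 < M <= n -> 2 <= q -> 100 <= L ->
  G (tau + M) -> G o -> G t -> G i -> homog_right G F W tau M mu ->
  small_noise G W n q tau (tau + M) ->
  t < o -> i < t -> tau <= i -> 10 * (t - tau) <= M ->
  no_insertion F n q L t (tau + M) o ->
  cusum_sq F i t o <= 3 / 4 * L * threshold_sq n q i t o.
Proof.
move=> Mn q2 L1 GM Go Gt Gi hF hW to it taui tM noin.
rewrite -cusum_sq_refl -threshold_sq_refl.
have E : - (tau + M) = - tau - M by rewrite opprD.
apply: (removal_left (G := fun z => G (- z)) (tau := - tau) (M := M) (mu := mu)
    (W := refl W) (n := n)) => //; rewrite ?opprK -?E ?opprK//; try lra.
- exact: homog_refl_l.
- exact: small_noise_refl.
- exact: no_insertion_refl.
Qed.


(** The energy condition at scale [M]; the factor 100 leaves room for the numerical constants of the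
    comparisons. [high_energy_min] derives it from [high_energy]. *)
Definition detectable n q L M D : Prop := L * level n q M <= (D / 100) ^+ 2 * M.

(** Clipping a window at distance of order [M] barely changes its mean: [avg_noinsertion] bounds the
    squared change by about [2 * L * level n q M / M], which detectability makes smaller than
    [(D / 40) ^+ 2]. The ratio 19/20 allows for an end [t] lying up to [M / 20] inside the
    window. *)
Lemma clip_error F n q L M D o m t :
  0 < M -> 2 * M <= n -> 3 <= q -> 0 <= L -> 0 <= D ->
  detectable n q L M D ->
  o < m -> m < t -> t - m <= n -> 19 * M <= 20 * (t - m) ->
  cusum_sq F o m t <= L * threshold_sq n q o m t -> `|avg F o t - avg F m t| <= D / 40.
Proof.
rewrite /detectable => M0 Mn q3 L0 D0 hD om mt tn tM hc.
have n0 : 0 < n by lra.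
have := avg_noinsertion n0 L0 (_ : 0 <= q) om mt tn hc.
set e := avg F o t - avg F m t => /(_ (ltac:(lra))) he.
have LamM : q <= level n q M by apply: level_ge; lra.
have h1 : level n q (t - m) <= level n q M + 1.
  have -> : level n q M + 1 = level n q M + 2 * (1 / 2) by lra.
  have h : ln (20 / 19 : R) <= 1 / 2 by have := @ln_leB1 R (20 / 19); lra.
  apply: le_trans (_ : level n q M + 2 * ln (20 / 19) <= _); last by lra.
  rewrite /level -addrA -mulrDr lerD2l ler_pM2l// -lnM ?posrE ?divr_gt0//.
  rewrite ler_ln ?posrE ?mulr_gt0 ?divr_gt0 ?invr_gt0//; try lra.
  rewrite -!mulrA ler_pM2l// ler_pdivlMl ?ler_pdivrMr; lra.
have h2 : L * (level n q (t - m) + 2) <= L * (2 * level n q M).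
  by apply: ler_wpM2l => //; lra.
have h3 : e ^+ 2 * (19 / 20 * M) <= e ^+ 2 * (t - m).
  by apply: ler_wpM2l; [exact: sqr_ge0|lra].
have h4 : (e ^+ 2) * M <= ((D / 40) ^+ 2) * M.
  have -> : (D / 40) ^+ 2 * M = D ^+ 2 * M / (40 * 40) by field.
  have : 0 <= D ^+ 2 * M by rewrite mulr_ge0 ?sqr_ge0 ?(ltW M0).
  lra.
rewrite ler_pM2r// in h4.
by rewrite -(@ler_pXn2r _ 2) ?nnegrE ?divr_ge0 ?ler0n// real_normK ?num_real.
Qed.

(** The constant comes from [1 / 2 * (1 - 2 / 40) - 1 / 40 = 9 / 20], whose square exceeds 1/5. *)
Lemma jump_norm (dl a b e f X : R) : `|a| <= `|dl| / 40 -> `|b| <= `|dl| / 40 ->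
  `|e| <= `|dl| / 40 -> 1 / 2 <= f -> X - e = f * (dl + a - b) ->
  `|dl| ^+ 2 / 5 <= X ^+ 2.
Proof.
move=> ha hb he hf hX; have D0 : 0 <= `|dl| by exact: normr_ge0.
have h1 : `|dl| - `|dl| / 20 <= `|dl + a - b|.
  have := ler_normD (dl + a - b) (b - a); have := ler_normB b a.
  have -> : dl + a - b + (b - a) = dl by ring.
  lra.
have h2 : (`|dl| - `|dl| / 20) / 2 <= `|X - e|.
  rewrite hX normrM ger0_norm; last by lra.
  apply: le_trans (_ : 1 / 2 * (`|dl| - `|dl| / 20) <= _); first by lra.
  by apply: ler_pM => //; lra.
have h3 : `|dl| * (9 / 20) <= `|X| by have := ler_normB X e; lra.
rewrite -(real_normK (num_real X)).
have : (`|dl| * (9 / 20)) ^+ 2 <= `|X| ^+ 2 by rewrite ler_pXn2r ?nnegrE ?mulr_ge0//; lra.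
have := sqr_ge0 `|dl|; lra.
Qed.

(** What inserting [tau] gains in fit. The window is clipped on the right at [tau + M], where the
    signal is known; there the contrast is a fraction [f >= 1 / 2] of the jump, up to the noise
    means and the clipping error. *)
Lemma jump_energy G F W n q L tau M mu1 mu2 d0 u v :
  0 < M -> 2 * M <= n -> 3 <= q -> 0 <= L ->
  G tau -> G (tau + M) -> G u -> G v ->
  tau - M <= u -> u < tau -> tau < v -> d0 <= tau - u -> tau - u <= v - tau ->
  tau - u <= M ->
  homog_left G F W tau M mu1 -> homog_right G F W tau M mu2 ->
  detectable n q L M `|mu2 - mu1| ->
  (forall z, G z -> d0 <= tau - z <= M ->
     `|W tau - W z| <= `|mu2 - mu1| / 40 * (tau - z)) ->
  (forall z, G z -> d0 <= z - tau <= M ->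
     `|W z - W tau| <= `|mu2 - mu1| / 40 * (z - tau)) ->
  no_insertion F n q L u (tau + M) v ->
  `|mu2 - mu1| ^+ 2 / 5 * (tau - u) <= cusum_sq F u tau v.
Proof.
set D := `|mu2 - mu1| => M0 Mn q3 L0 Gt GM Gu Gv uM ut tv du uv xM hl hr hD wl wr noin.
have D0 : 0 <= D by exact: normr_ge0.
have x0 : 0 < tau - u by lra.
(* [r] is the smaller of [v] and [tau + M]; [clip_error] is applied to the reflected data when [v]
   is the larger one. *)
have [r [Gr tr rv rM [xr herr]]] : exists r, [/\ G r, tau < r, r <= v, r <= tau + M &
    tau - u <= r - tau /\ `|avg F u v - avg F u r| <= D / 40].
  have [vM|Mv] := leP v (tau + M).
    by exists v; split=> //; split; [lra | rewrite subrr normr0 divr_ge0// ler0n].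
  exists (tau + M); split; [exact: GM|lra|lra|lra|split; first by lra].
  have [h1 h2] : u < tau + M /\ tau + M < v by split; lra.
  have -> : `|avg F u v - avg F u (tau + M)| =
      `|avg (refl F) (- v) (- u) - avg (refl F) (- (tau + M)) (- u)|.
    by rewrite !avg_refl.
  apply: (clip_error (n := n) (q := q) (L := L) (M := M)) => //; try lra.
  by rewrite cusum_sq_refl threshold_sq_refl; exact: noin.
move: herr; set X := avg F u v - avg F u tau.
have hwl : `|avg W u tau| <= D / 40.
  have := wl u Gu (ltac:(lra)).
  by rewrite /avg normrM normfV (gtr0_norm x0) ler_pdivrMr.
have hwr : `|avg W tau r| <= D / 40.
  have := wr r Gr (ltac:(lra)).
  have r0 : 0 < r - tau by lra.
  by rewrite /avg normrM normfV (gtr0_norm r0) ler_pdivrMr.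
pose f := (r - tau) / (r - u).
have f2 : 1 / 2 <= f by rewrite /f ler_pdivlMr; lra.
have E : avg F u r - avg F u tau = f * (mu2 - mu1 + avg W tau r - avg W u tau).
  have -> : mu2 - mu1 + avg W tau r - avg W u tau = avg F tau r - avg F u tau.
    rewrite (avg_homog_left hl Gu Gt)//.
    by rewrite (avg_homog_right hr Gt Gr)//; ring.
  have ru : u < r by exact: lt_trans tr.
  by rewrite /f /avg; field; rewrite !gt_eqF// subr_gt0.
move=> herr.
have hX2 : D ^+ 2 / 5 <= X ^+ 2.
  apply: (jump_norm hwr hwl herr f2); rewrite -E /X; ring.
(* Expressed through [avg F u v - avg F u tau], the CUSUM has a weight of at least [tau - u],
   whatever the position of [v]. *)
have -> : cusum_sq F u tau v = X ^+ 2 * ((tau - u) * ((v - u) / (v - tau))).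
  have vu : u < v by exact: lt_trans tv.
  by rewrite /cusum_sq /X /avg; field; rewrite !gt_eqF// subr_gt0.
apply: ler_pM => //.
- by rewrite divr_ge0// sqr_ge0.
- exact: ltW.
- by rewrite -[leLHS]mulr1 ler_pM2l// ler_pdivlMr; lra.
Qed.

(** What deleting [u] loses in fit once [tau] is present. Both means are close to [mu1]: the noise
    contributes [D / 40] and [3 * D / 40], the clipping [D / 40], in total [D / 8]. *)
Lemma merge_energy G F W n q L tau M mu1 D d0 u' u :
  0 < M -> 2 * M <= n -> 3 <= q -> 0 <= L -> 0 <= D ->
  G tau -> G (tau - M) -> G u -> G u' ->
  u' < u -> u < tau -> d0 <= tau - u -> 20 * (tau - u) <= M -> M < 10 * (tau - u') ->
  homog_left G F W tau M mu1 ->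
  detectable n q L M D ->
  (forall z, G z -> d0 <= tau - z <= M -> `|W tau - W z| <= D / 40 * (tau - z)) ->
  no_insertion F n q L u' (tau - M) u ->
  cusum_sq F u' u tau <= D ^+ 2 / 64 * (tau - u).
Proof.
move=> M0 Mn q3 L0 D0 Gt GM Gu Gu' u'u ut du xM u'M hl hD wl noin.
have x0 : 0 < tau - u by lra.
have [m [Gm mu um mM [xm herr]]] : exists m, [/\ G m, m < u, u' <= m, tau - M <= m &
    2 * (tau - u) <= tau - m /\ `|avg F u' u - avg F m u| <= D / 40].
  have [vM|Mv] := leP (tau - M) u'.
    by exists u'; split=> //; split; [lra | rewrite subrr normr0 divr_ge0// ler0n].
  exists (tau - M); split; [exact: GM|lra|lra|lra|split; first by lra].
  have [h1 h2] : u' < tau - M /\ tau - M < u by split; lra.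
  apply: (clip_error (n := n) (q := q) (L := L) (M := M)) => //; try lra.
  exact: noin.
have hwu := wl u Gu (ltac:(lra)).
have hwm := wl m Gm (ltac:(lra)).
have hu : `|avg W u tau| <= D / 40.
  by rewrite /avg normrM normfV (gtr0_norm x0) ler_pdivrMr.
(* Noise bounds are available only for intervals ending at [tau], so the interval from [m] to [u] is
   a difference of two of them; the factor 3 comes from [2 * (tau - u) <= tau - m]. *)
have hm : `|avg W m u| <= 3 * (D / 40).
  have p0 : 0 < u - m by lra.
  rewrite /avg normrM normfV (gtr0_norm p0) ler_pdivrMr//.
  have -> : W u - W m = (W tau - W m) - (W tau - W u) by ring.
  apply: le_trans (ler_normB _ _) _.
  apply: le_trans (lerD hwm hwu) _.
  rewrite -mulrDr [leRHS]mulrAC [leRHS]mulrC ler_wpM2l//; [by rewrite divr_ge0| lra].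
set X := avg F u tau - avg F u' u.
have hX : `|X| <= D / 8.
  have E : X = avg W u tau - (avg W m u + (avg F u' u - avg F m u)).
    rewrite /X (avg_homog_left hl Gu Gt)//; try lra.
    by rewrite (avg_homog_left hl Gm Gu)//; try lra.
  rewrite E; apply: le_trans (ler_normB _ _) _.
  have := ler_normD (avg W m u) (avg F u' u - avg F m u); lra.
have hX2 : X ^+ 2 <= D ^+ 2 / 64.
  rewrite -(real_normK (num_real X)).
  have -> : D ^+ 2 / 64 = (D / 8) ^+ 2 by field.
  by rewrite ler_pXn2r ?nnegrE// divr_ge0.
rewrite /cusum_sq -/X; apply: ler_pM => //; first exact: sqr_ge0.
  by clear -u'u ut; rewrite divr_ge0 ?mulr_ge0//; lra.
rewrite ler_pdivrMr; last by lra.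
rewrite mulrC ler_pM2l//; clear -ut; lra.
Qed.

(** The last three hypotheses express that the criterion does not decrease when [u'] is deleted,
    when [u] is moved to [tau], and when [u] is moved to [tau] while [v] is deleted. They are
    incompatible. *)
Lemma move_left_point_suboptimal G F W n q L tau M mu1 mu2 d0 u' u v :
  0 < M -> 2 * M <= n -> 100 <= q -> 100 <= L ->
  G tau -> G (tau - M) -> G (tau + M) -> G u' -> G u -> G v ->
  homog_left G F W tau M mu1 -> homog_right G F W tau M mu2 ->
  small_noise G W n q (tau - M) tau -> small_noise G W n q tau (tau + M) ->
  detectable n q L M `|mu2 - mu1| ->
  (forall z, G z -> d0 <= tau - z <= M ->
     `|W tau - W z| <= `|mu2 - mu1| / 40 * (tau - z)) ->
  (forall z, G z -> d0 <= z - tau <= M ->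
     `|W z - W tau| <= `|mu2 - mu1| / 40 * (z - tau)) ->
  u' < u -> u < tau -> tau < v ->
  d0 <= tau - u -> tau - u <= v - tau -> 20 * (tau - u) <= M ->
  no_insertion F n q L u' (tau - M) u -> no_insertion F n q L u (tau + M) v ->
  (10 * (tau - u') <= M -> exists u'', [/\ G u'', u'' < u',
     no_insertion F n q L u'' (tau - M) u' &
     L * threshold_sq n q u'' u' u <= cusum_sq F u'' u' u]) ->
  cusum_sq F u tau v + L * threshold_sq n q u' u tau <=
     L * threshold_sq n q u tau v + cusum_sq F u' u tau ->
  (10 * (v - tau) <= M -> exists v', [/\ G v', v < v',
     no_insertion F n q L v (tau + M) v' &
     cusum_sq F u tau v + L * threshold_sq n q u' u tau + L * threshold_sq n q tau v v' <=
     L * threshold_sq n q u tau v + cusum_sq F u' u tau + cusum_sq F tau v v']) ->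
  False.
Proof.
set D := `|mu2 - mu1|.
move=> M0 Mn q1 L1 Gt GMl GMr Gu' Gu Gv hl hr nl nr hD wl wr u'u ut tv du uv xM
  noin1 noin2 prev move1 move2.
have n0 : 0 < n by clear -M0 Mn; lra.
have Mn1 : 0 < M <= n by clear -M0 Mn; lra.
have q2 : 2 <= q by clear -q1; lra.
have q3 : 3 <= q by clear -q1; lra.
have L0 : 0 <= L by clear -L1; lra.
have D0 : 0 <= D by exact: normr_ge0.
have x0 : 0 < tau - u by rewrite subr_gt0.
have y0 : 0 < v - tau by rewrite subr_gt0.
have [xM1 Mu] : tau - u <= M /\ tau - M <= u by clear -xM M0 x0; split; lra.
(* A point [u'] within [M / 10] of [tau] could be deleted with profit, by [removal_left]. *)
have u'M : M < 10 * (tau - u').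
  rewrite ltNge; apply/negP => u'M; have [u'' [Gu'' u''u' noin noin']] := prev u'M.
  have := removal_left (W := W) (mu := mu1) (n := n) (q := q) (L := L) (M := M)
    (G := G) (tau := tau) (o := u'') (t := u') (i := u) (F := F).
  have Lth : 0 < L * threshold_sq n q u'' u' u.
    apply: mulr_gt0; first by clear -L1; lra.
    apply: lt_le_trans (threshold_sq_ge_r q n0 u''u' u'u).
    by apply: lt_le_trans (level_ge _ _); clear -q1 M0 Mn u'M u'u ut; lra.
  move=> /(_ Mn1 q2 L1 GMl Gu'' Gu' Gu hl nl u''u' u'u (ltW ut) u'M noin).
  clear -noin' Lth; lra.
have hj : D ^+ 2 / 5 * (tau - u) <= cusum_sq F u tau v.
  by apply: (jump_energy (G := G) (W := W) (n := n) (q := q) (L := L) (M := M) (d0 := d0)).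
have hm : cusum_sq F u' u tau <= D ^+ 2 / 64 * (tau - u).
  by apply: (merge_energy (G := G) (W := W) (n := n) (q := q) (L := L) (M := M) (mu1 := mu1) (d0 := d0)).
have ht : L * threshold_sq n q u tau v - L * threshold_sq n q u' u tau <= L * (2 * ((tau - u) / (v - tau))).
  by rewrite -mulrBr ler_wpM2l//; exact: threshold_sq_sub.
have D2x : 0 <= D ^+ 2 * (tau - u) by rewrite mulr_ge0 ?sqr_ge0// ltW.
(* The move may raise the penalty by up to [2 * L * (tau - u) / (v - tau)], hence by at most
   [2 * L]. If [v] is close, deleting it saves at least a quarter of [L] times a threshold that is
   at least 100, which pays for this. *)
have [yM|My] := leP (10 * (v - tau)) M.
  have [v' [Gv' vv' noin hc]] := move2 yM.
  have := removal_right (W := W) (mu := mu2) (n := n) (q := q) (L := L) (M := M)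
    (G := G) (tau := tau) (i := tau) (t := v) (o := v') (F := F).
  move=> /(_ Mn1 q2 L1 GMr Gv' Gv Gt hr nr vv' tv (lexx _) yM noin) hrem.
  have thq : 100 <= threshold_sq n q tau v v'.
    apply: le_trans (threshold_sq_ge_l q n0 tv vv'); apply: le_trans q1 (level_ge _ _).
    by clear -y0 yM M0 Mn; lra.
  have Lth : L * 100 <= L * threshold_sq n q tau v v' by rewrite ler_wpM2l.
  have r1 : (tau - u) / (v - tau) <= 1 by rewrite ler_pdivrMr ?mul1r.
  have Lr : L * (2 * ((tau - u) / (v - tau))) <= L * 2.
    by rewrite ler_wpM2l//; clear -r1; lra.
  clear -hc hrem Lth Lr ht hj hm D2x L1; lra.
(* If [v] is far, the rise is at most [20 * L / M * (tau - u)], which detectability makes less than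
   [D ^+ 2 / 10 * (tau - u)]; and 1/10 + 1/64 < 1/5. *)
have hr1 : (tau - u) / (v - tau) <= 10 * (tau - u) / M.
  rewrite ler_pdivrMr// mulrAC ler_pdivlMr// -mulrA mulrCA ler_pM2l//.
  by clear -My; lra.
have Lr : L * (2 * ((tau - u) / (v - tau))) <= L * (2 * (10 * (tau - u) / M)).
  by rewrite ler_wpM2l//; clear -hr1; lra.
have hx : L * (2 * (10 * (tau - u) / M)) < D ^+ 2 / 10 * (tau - u).
  have -> : L * (2 * (10 * (tau - u) / M)) = 20 * L / M * (tau - u) by ring.
  rewrite ltr_pM2r// ltr_pdivrMr//.
  have := hD; rewrite /detectable.
  have : L * 1 <= L * level n q M.
    by rewrite ler_wpM2l//; apply: le_trans (level_ge _ _) => //; clear -q1; lra.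
  clear -L1; lra.
clear -move1 hj hm ht Lr hx D2x; lra.
Qed.

Lemma move_right_point_suboptimal G F W n q L tau M mu1 mu2 d0 u v v' :
  0 < M -> 2 * M <= n -> 100 <= q -> 100 <= L ->
  G tau -> G (tau - M) -> G (tau + M) -> G u -> G v -> G v' ->
  homog_left G F W tau M mu1 -> homog_right G F W tau M mu2 ->
  small_noise G W n q (tau - M) tau -> small_noise G W n q tau (tau + M) ->
  detectable n q L M `|mu2 - mu1| ->
  (forall z, G z -> d0 <= tau - z <= M ->
     `|W tau - W z| <= `|mu2 - mu1| / 40 * (tau - z)) ->
  (forall z, G z -> d0 <= z - tau <= M ->
     `|W z - W tau| <= `|mu2 - mu1| / 40 * (z - tau)) ->
  u < tau -> tau < v -> v < v' ->
  d0 <= v - tau -> v - tau <= tau - u -> 20 * (v - tau) <= M ->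
  no_insertion F n q L v (tau + M) v' -> no_insertion F n q L u (tau - M) v ->
  (10 * (v' - tau) <= M -> exists v'', [/\ G v'', v' < v'',
     no_insertion F n q L v' (tau + M) v'' &
     L * threshold_sq n q v v' v'' <= cusum_sq F v v' v'']) ->
  cusum_sq F u tau v + L * threshold_sq n q tau v v' <=
     L * threshold_sq n q u tau v + cusum_sq F tau v v' ->
  (10 * (tau - u) <= M -> exists u', [/\ G u', u' < u,
     no_insertion F n q L u' (tau - M) u &
     cusum_sq F u tau v + L * threshold_sq n q u' u tau + L * threshold_sq n q tau v v' <=
     L * threshold_sq n q u tau v + cusum_sq F u' u tau + cusum_sq F tau v v']) ->
  False.
Proof.
move=> M0 Mn q1 L1 Gt GMl GMr Gu Gv Gv' hl hr nl nr hD wl wr ut tv vv' dv vu yM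
  noin1 noin2 next move1 move2.
have El : - tau - M = - (tau + M) by rewrite opprD.
have Er : - tau + M = - (tau - M) by rewrite opprB addrC.
apply: (@move_left_point_suboptimal (fun z => G (- z)) (refl F) (refl W) n q L (- tau) M mu2 mu1 d0
   (- v') (- v) (- u)) => //; rewrite ?El ?Er ?opprK// ?(distrC mu1) ?cusum_sq_refl ?threshold_sq_refl//;
  try (clear -ut tv vv' dv vu yM; lra).
- exact: homog_refl_l.
- exact: homog_refl_r.
- exact: small_noise_refl.
- exact: small_noise_refl.
- move=> z Gz; rewrite (_ : - tau - z = - z - tau); last by ring.
  rewrite (_ : refl W (- tau) - refl W z = W (- z) - W tau); last first.
    by rewrite /refl !opprK addrC.
  exact: wr.
- move=> z Gz; rewrite (_ : z + tau = tau - - z); last by rewrite opprK addrC.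
  rewrite (_ : refl W z + W tau = W tau - W (- z)); last by rewrite /refl addrC.
  exact: wl.
- exact: no_insertion_refl.
- exact: no_insertion_refl.
- move=> h; have yM1 : 10 * (v' - tau) <= M by clear -h; lra.
  have [v'' [Gv'' v'v'' noin hc]] := next yM1.
  exists (- v''); rewrite opprK; split; [exact: Gv''| by rewrite ltrN2 | |].
    exact: no_insertion_refl.
  by rewrite cusum_sq_refl threshold_sq_refl.
- move=> h; have xM1 : 10 * (tau - u) <= M by clear -h; lra.
  have [u' [Gu' u'u noin hc]] := move2 xM1.
  exists (- u'); rewrite opprK; split; [exact: Gu'| by rewrite ltrN2 | |].
    exact: no_insertion_refl.
  rewrite !cusum_sq_refl !threshold_sq_refl; clear -hc; lra.
Qed.

End Local.

(** * Optimality inequalities for a minimizer under insertions, deletions and moves *)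

Section Minimizer.
Context (R : realType).
Implicit Types (n u t v : nat) (L q : R) (s : seq nat).

Lemma cusum_sq_ge0 (F : R -> R) (a t b : R) : a <= t -> t <= b -> 0 <= cusum_sq F a t b.
Proof.
move=> at_ tb; rewrite mulr_ge0 ?sqr_ge0// divr_ge0 ?mulr_ge0//; lra.
Qed.

Lemma minimizer_insert n L q (y : 'rV[R]_n) s1 s2 t :
  is_minimizer L q y (s1 ++ s2) -> (last 1 s1 < t)%N -> (t < head n.+1 s2)%N ->
  cusum_sq (psum y) (last 1%N s1)%:R t%:R (head n.+1 s2)%:R <=
  L * threshold_sq n%:R q (last 1%N s1)%:R t%:R (head n.+1 s2)%:R.
Proof.
move=> [cs smin] ut tv; have cs' := cpv_insert cs ut tv.
by have := smin _ cs'; rewrite Cr0_insert//; lra.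
Qed.

Lemma minimizer_remove n L q (y : 'rV[R]_n) s1 s2 t :
  is_minimizer L q y (s1 ++ t :: s2) ->
  L * threshold_sq n%:R q (last 1%N s1)%:R t%:R (head n.+1 s2)%:R <=
  cusum_sq (psum y) (last 1%N s1)%:R t%:R (head n.+1 s2)%:R.
Proof.
move=> [cs smin]; have cs' := cpv_remove cs.
by have := smin _ cs'; rewrite Cr0_insert//; lra.
Qed.

(** A move is an insertion followed by a deletion; [Cr0_insert] compares both vectors with their
    common refinement. *)
Lemma minimizer_move_right n L q (y : 'rV[R]_n) s1 s2 u t :
  is_minimizer L q y (s1 ++ u :: s2) -> (u < t)%N -> (t < head n.+1 s2)%N ->
  cusum_sq (psum y) u%:R t%:R (head n.+1 s2)%:R + L * threshold_sq n%:R q (last 1%N s1)%:R u%:R t%:R <=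
  L * threshold_sq n%:R q u%:R t%:R (head n.+1 s2)%:R
    + cusum_sq (psum y) (last 1%N s1)%:R u%:R t%:R.
Proof.
move=> [cs smin] ut tv.
have cs1 : is_cpv n (rcons s1 u ++ t :: s2).
  by apply: cpv_insert; rewrite ?last_rcons ?cat_rcons.
have cs' : is_cpv n (s1 ++ u :: t :: s2) by rewrite -cat_rcons.
have := smin _ (cpv_remove cs').
have := Cr0_insert L q y cs1; have := Cr0_insert L q y cs'.
rewrite !last_rcons !cat_rcons /=; lra.
Qed.

Lemma minimizer_move_left n L q (y : 'rV[R]_n) s1 s2 t v :
  is_minimizer L q y (s1 ++ v :: s2) -> (last 1 s1 < t)%N -> (t < v)%N ->
  cusum_sq (psum y) (last 1%N s1)%:R t%:R v%:R + L * threshold_sq n%:R q t%:R v%:R (head n.+1 s2)%:R <=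
  L * threshold_sq n%:R q (last 1%N s1)%:R t%:R v%:R
    + cusum_sq (psum y) t%:R v%:R (head n.+1 s2)%:R.
Proof.
move=> [cs smin] ut tv.
have cs1 : is_cpv n (s1 ++ t :: v :: s2) by exact: cpv_insert.
have cs' : is_cpv n (rcons s1 t ++ v :: s2) by rewrite cat_rcons.
have := smin _ (cpv_remove cs').
have := Cr0_insert L q y cs1; have := Cr0_insert L q y cs'.
rewrite !last_rcons !cat_rcons /=; lra.
Qed.

Lemma minimizer_merge n L q (y : 'rV[R]_n) s1 s2 u t v :
  is_minimizer L q y (s1 ++ u :: v :: s2) -> (u < t)%N -> (t < v)%N ->
  cusum_sq (psum y) u%:R t%:R v%:R + L * threshold_sq n%:R q (last 1%N s1)%:R u%:R t%:R
    + L * threshold_sq n%:R q t%:R v%:R (head n.+1 s2)%:R <=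
  L * threshold_sq n%:R q u%:R t%:R v%:R + cusum_sq (psum y) (last 1%N s1)%:R u%:R t%:R
    + cusum_sq (psum y) t%:R v%:R (head n.+1 s2)%:R.
Proof.
move=> [cs smin] ut tv.
have cs1 : is_cpv n (rcons s1 u ++ t :: v :: s2).
  by apply: cpv_insert; rewrite ?last_rcons ?cat_rcons.
have cs' : is_cpv n (s1 ++ u :: t :: v :: s2) by rewrite -cat_rcons.
have cs3 : is_cpv n (rcons s1 t ++ v :: s2) by rewrite cat_rcons; exact: cpv_remove cs'.
have := smin _ (cpv_remove cs3).
have := Cr0_insert L q y cs1; have := Cr0_insert L q y cs'.
have := Cr0_insert L q y cs3.
rewrite !last_rcons !cat_rcons /=; lra.
Qed.

(** An auxiliary point costs at most its penalty, since its squared CUSUM is nonnegative; if [p]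
    already is the neighbouring point, nothing is inserted. *)
Lemma insert_before n L q (y : 'rV[R]_n) s1 s2 p (X : R) :
  is_cpv n (s1 ++ s2) -> (last 1 s1 <= p)%N -> (p < head n.+1 s2)%N -> 0 <= X ->
  ((last 1 s1 < p)%N ->
     L * threshold_sq n%:R q (last 1%N s1)%:R p%:R (head n.+1 s2)%:R <= X) ->
  exists s1', [/\ last 1%N s1' = p, is_cpv n (s1' ++ s2) &
     Cr0 L q y (s1' ++ s2) <= Cr0 L q y (s1 ++ s2) + X].
Proof.
move=> cs; rewrite leq_eqVlt => /predU1P[up|up] pv X0 hX.
  by exists s1; split=> //; rewrite lerDl.
have cs' := cpv_insert cs up pv.
exists (rcons s1 p); rewrite last_rcons cat_rcons; split=> //.
rewrite Cr0_insert//; have := hX up.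
have : 0 <= cusum_sq (psum y) (last 1%N s1)%:R p%:R (head n.+1 s2)%:R.
  by apply: cusum_sq_ge0; rewrite ler_nat ltnW.
lra.
Qed.

Lemma insert_after n L q (y : 'rV[R]_n) s1 s2 p (X : R) :
  is_cpv n (s1 ++ s2) -> (last 1 s1 < p)%N -> (p <= head n.+1 s2)%N -> 0 <= X ->
  ((p < head n.+1 s2)%N ->
     L * threshold_sq n%:R q (last 1%N s1)%:R p%:R (head n.+1 s2)%:R <= X) ->
  exists s2', [/\ head n.+1 s2' = p, is_cpv n (s1 ++ s2') &
     Cr0 L q y (s1 ++ s2') <= Cr0 L q y (s1 ++ s2) + X].
Proof.
move=> cs up; rewrite leq_eqVlt => /predU1P[pv|pv] X0 hX.
  by exists s2; split=> //; rewrite lerDl.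
have cs' := cpv_insert cs up pv.
exists (p :: s2); split=> //.
rewrite Cr0_insert//; have := hX pv.
have : 0 <= cusum_sq (psum y) (last 1%N s1)%:R p%:R (head n.+1 s2)%:R.
  by apply: cusum_sq_ge0; rewrite ler_nat ltnW.
lra.
Qed.

(** The auxiliary points [p] and [r] isolate a window around [t] at a cost of at most [X] each, so
    that the signal outside the window does not enter the CUSUM at [t]. *)
Lemma minimizer_insert3 n L q (y : 'rV[R]_n) s1 s2 p t r (X : R) :
  is_minimizer L q y (s1 ++ s2) -> 0 <= X ->
  (last 1 s1 <= p)%N -> (p < t)%N -> (t < r)%N -> (r <= head n.+1 s2)%N ->
  ((last 1 s1 < p)%N ->
     L * threshold_sq n%:R q (last 1%N s1)%:R p%:R (head n.+1 s2)%:R <= X) ->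
  ((r < head n.+1 s2)%N -> L * threshold_sq n%:R q p%:R r%:R (head n.+1 s2)%:R <= X) ->
  cusum_sq (psum y) p%:R t%:R r%:R <= L * threshold_sq n%:R q p%:R t%:R r%:R + 2 * X.
Proof.
move=> [cs smin] X0 up pt tr rv hp hr.
have pv : (p < head n.+1 s2)%N by lia.
have [s1' [E1 cs1 h1]] := insert_before y cs up pv X0 hp.
have pr : (last 1 s1' < r)%N by rewrite E1; lia.
have hr' : (r < head n.+1 s2)%N ->
   L * threshold_sq n%:R q (last 1%N s1')%:R r%:R (head n.+1 s2)%:R <= X by rewrite E1.
have [s2' [E2 cs' h2]] := insert_after y cs1 pr rv X0 hr'.
have cs3 : is_cpv n (s1' ++ t :: s2') by apply: cpv_insert; rewrite ?E1 ?E2.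
have := smin _ cs3; rewrite Cr0_insert// E1 E2; lra.
Qed.

End Minimizer.

(** * The gain of inserting an isolated high-energy change-point *)

Section Detection.
Context (R : realType).
Implicit Types (n q L tau M mu a t b : R) (F W : R -> R) (G : R -> Prop).

(** Passing from scale [M] to [M / 20] adds [2 * ln 20 <= 38]; with the 2 of [threshold_sq_le], this
    is absorbed by [100 <= q]. *)
Lemma threshold_sq_le_level n q M a t b : 0 < M <= n -> 100 <= q -> a < t -> t < b ->
  M <= 20 * (t - a) -> M <= 20 * (b - t) -> threshold_sq n q a t b <= 2 * level n q M.
Proof.
move=> /andP[M0 Mn] q1 at_ tb hM1 hM2; have n0 : 0 < n by lra.
have Lq : q <= level n q M by apply: level_ge; lra.
have : threshold_sq n q a t b <= level n q (M / 20) + 2 by apply: threshold_sq_le => //; lra.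
suff : level n q (M / 20) <= level n q M + 2 * 19 by lra.
have -> : level n q (M / 20) = level n q M + 2 * ln 20.
  rewrite /level (_ : n / (M / 20) = n / M * 20); last by field; rewrite gt_eqF.
  by rewrite lnM ?posrE ?divr_gt0//; ring.
have := @ln_leB1 R 20; lra.
Qed.

(** The left-hand side pays for two auxiliary points at [2 * L * level n q M] each. The weight is at
    least [M / 40], so the jump contributes at least [D ^+ 2 * M / 80], that is 125 times
    [L * level n q M], from which a noise term and one penalty are subtracted. *)
Lemma detection_energy G F W n q L tau M mu1 mu2 p r :
  0 < M -> 2 * M <= n -> 100 <= q -> 100 <= L ->
  G tau -> G p -> G r ->
  homog_left G F W tau M mu1 -> homog_right G F W tau M mu2 ->
  cusum_sq W p tau r <= 4 * threshold_sq n q p tau r ->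
  detectable n q L M `|mu2 - mu1| ->
  p < tau -> tau < r -> tau - M <= p -> r <= tau + M ->
  M <= 20 * (tau - p) -> M <= 20 * (r - tau) ->
  4 * (L * level n q M) < cusum_sq F p tau r - L * threshold_sq n q p tau r.
Proof.
move=> M0 Mn q1 L1 Gt Gp Gr hl hr hW; rewrite /detectable; set D := `|mu2 - mu1|.
have -> : (D / 100) ^+ 2 * M = D ^+ 2 * M / 100 / 100 by field.
move=> hD pt tr pM rM hp hr'.
have hth : threshold_sq n q p tau r <= 2 * level n q M by apply: threshold_sq_le_level => //; lra.
have Lq : 100 <= level n q M by apply: le_trans q1 (level_ge _ _); lra.
have E : avg F tau r - avg F p tau = (mu2 - mu1) + (avg W tau r - avg W p tau).
  rewrite (avg_homog_left hl Gp Gt)//.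
  by rewrite (avg_homog_right hr Gt Gr)//; ring.
clear hl hr Gt Gp Gr.
set w := (tau - p) * (r - tau) / (r - p).
have wM : M / 40 <= w.
  have rp : 0 < r - p by lra.
  rewrite ler_pdivlMr//.
  have h1 : M * (tau - p) <= 20 * (r - tau) * (tau - p) by rewrite ler_wpM2r//; lra.
  have h2 : M * (r - tau) <= 20 * (tau - p) * (r - tau) by rewrite ler_wpM2r//; lra.
  lra.
have w0 : 0 < w by lra.
set N := avg W tau r - avg W p tau in E.
have hN : N ^+ 2 * w <= 8 * level n q M by move: hW; rewrite /cusum_sq -/N -/w; lra.
have D2 : D ^+ 2 = (mu2 - mu1) ^+ 2 by rewrite real_normK// num_real.
have hsq : D ^+ 2 / 2 * w <= (mu2 - mu1 + N) ^+ 2 * w + N ^+ 2 * w.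
  rewrite -mulrDl ler_wpM2r//; [lra|].
  by rewrite D2; have := sqr_ge0 ((mu2 - mu1) + 2 * N); lra.
have hw : D ^+ 2 / 2 * (M / 40) <= D ^+ 2 / 2 * w.
  by rewrite ler_wpM2l// divr_ge0 ?sqr_ge0.
have hL : L * threshold_sq n q p tau r <= L * (2 * level n q M) by rewrite ler_wpM2l//; lra.
have hLL : 100 * level n q M <= L * level n q M by rewrite ler_wpM2r//; lra.
have -> : cusum_sq F p tau r = (mu2 - mu1 + N) ^+ 2 * w by rewrite /cusum_sq E.
clear -hD hN hsq hw hL hLL Lq; lra.
Qed.

End Detection.

Ltac nat_lia :=
  repeat match goal with
  | H : ?P |- _ => lazymatch P with
      | nat => fail | 'I_ _ => fail
      | is_true (leq _ _) => fail | is_true (andb _ _) => fail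
      | _ => clear H end
  end; lia.

(** * Deterministic localization of a high-energy change-point *)

Section Localization.
Context (R : realType).

(* Noise bounds only hold at the integer positions. *)
Definition grid (n : nat) (z : R) := exists2 j : nat, (1 <= j <= n.+1)%N & z = j%:R.

Lemma sorted_split (s : seq nat) t : sorted ltn s -> t \notin s ->
  exists s1 s2, [/\ s = s1 ++ s2, all (fun x => x < t)%N s1 &
                    all (fun x => t < x)%N s2].
Proof.
elim: s => [|x s IH]; first by exists [::], [::].
move=> xs; rewrite inE negb_or => /andP[tx ts].
have [xt|tx'] := ltnP x t.
  have [s1 [s2 [E h1 h2]]] := IH (path_sorted xs) ts.
  by exists (x :: s1), s2; rewrite E /= xt.
have {tx tx'}tx : (t < x)%N by rewrite ltn_neqAle tx.
exists [::], (x :: s); split=> //=; rewrite tx.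
have := order_path_min ltn_trans xs; apply: sub_all => z; exact: ltn_trans.
Qed.

Lemma psum_const n (theta e : 'rV[R]_n) (mu : R) (i j : nat) :
  (1 <= i)%N -> (i <= j)%N -> (j <= n.+1)%N ->
  (forall l : 'I_n, (i <= l.+1 < j)%N -> theta 0 l = mu) ->
  psum (theta + e) j%:R - psum (theta + e) i%:R =
    mu * (j%:R - i%:R) + (psum e j%:R - psum e i%:R).
Proof.
move=> i1 ij jn ht; rewrite -!psumB// -natrB// -(card_segment _ i1 ij jn).
rewrite mulr_sumr -big_split; apply: eq_bigr => l hl.
by rewrite mxE (ht l hl) mulr1.
Qed.

Lemma threshold_sqE n (q : R) (t1 t2 t3 : nat) : 0 <= q -> (1 <= t1)%N ->
  (t1 < t2)%N -> (t2 < t3)%N -> (t3 <= n.+1)%N ->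
  threshold n q t1 t2 t3 ^+ 2 = threshold_sq n%:R q t1%:R t2%:R t3%:R.
Proof.
move=> q0 t11 t12 t23 t3n.
have n0 : (0 : R) < n%:R by rewrite ltr0n; lia.
have l12 : t1%:R < t2%:R :> R by rewrite ltr_nat.
have l23 : t2%:R < t3%:R :> R by rewrite ltr_nat.
have t13 := ltn_trans t12 t23.
rewrite /threshold !natrM !natrB 1?ltnW//.
rewrite -/(threshold_sq n%:R q t1%:R t2%:R t3%:R) addrC sqr_sqrtr//.
apply: le_trans (threshold_sq_ge_r q n0 l12 l23).
apply: le_trans q0 (level_ge _ _); rewrite subr_gt0 l23 /=.
by rewrite -natrB 1?ltnW// ler_nat; lia.
Qed.

Lemma weightE t1 t2 t3 : (t1 < t2)%N -> (t2 < t3)%N ->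
  weight R t1 t2 t3 =
  (t2%:R - t1%:R) * (t3%:R - t2%:R) / (t3%:R - t1%:R).
Proof.
move=> t12 t23; have t13 := ltn_trans t12 t23.
by rewrite /weight natrM !natrB 1?ltnW.
Qed.

Lemma weight_ge0 t1 t2 t3 : 0 <= weight R t1 t2 t3.
Proof. by rewrite divr_ge0. Qed.

Lemma good_noise_cusum_sq n (q : R) (e : 'rV[R]_n) (t1 t2 t3 : nat) : 0 <= q ->
  good_noise q e -> (1 <= t1)%N -> (t1 < t2)%N -> (t2 < t3)%N ->
  (t3 <= n.+1)%N ->
  cusum_sq (psum e) t1%:R t2%:R t3%:R <= 4 * threshold_sq n%:R q t1%:R t2%:R t3%:R.
Proof.
move=> q0 he t11 t12 t23 t3n; have := he _ _ _ t11 t12 t23 t3n.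
have thr0 : 0 <= threshold n q t1 t2 t3 by exact: sqrtr_ge0.
rewrite -(@ler_pXn2r _ 2) ?nnegrE ?mulr_ge0// real_normK ?num_real//.
rewrite [leRHS]exprMn threshold_sqE//.
rewrite /cusum exprMn sqr_sqrtr ?weight_ge0// weightE// !mean_on_avg 1?ltnW//.
by have -> : 2 ^+ 2 = 4 :> R by ring.
Qed.

(** The weight is at most the shorter length [M], and the squared threshold is at least the level at
    [M]; it remains to square the energy condition and to use [L <= L ^+ 2]. *)
Lemma high_energy_min n (q L : R) (s : seq nat) (mu : nat -> R) (k M : nat) :
  100 <= q -> 100 <= L -> (0 < n)%N -> is_cpv n s -> (1 <= k <= size s)%N ->
  high_energy n (100 * L) q s mu k ->
  M = minn (cp n s k - cp n s k.-1) (cp n s k.+1 - cp n s k) ->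
  detectable n%:R q L M%:R `|jump mu k|.
Proof.
rewrite /detectable.
move=> q1 L1 n0 cs /andP[k1 ks] he.
have ab := cp_lt n0 cs ks.
have := @cp_lt n s k.-1 n0 cs; rewrite prednK// => /(_ (leq_trans (leq_pred k) ks)) ta.
have := @cp_le n s 0 k.-1 n0 cs; rewrite leq0n /= => /(_ (ltac:(lia))) a1.
have := @cp_le n s k.+1 (size s).+1 n0 cs; rewrite [cp n s (size s).+1]nth_default//.
move=> /(_ (ltac:(lia))) bn.
move: he; rewrite /high_energy => he ME; move: he ME.
move: (cp n s k) (cp n s k.-1) (cp n s k.+1) ta ab a1 bn => t a b ta ab a1 bn.
move=> /[swap] ME.
have at0 : a%:R < t%:R :> R by rewrite ltr_nat.
have tb0 : t%:R < b%:R :> R by rewrite ltr_nat.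
have n0' : (0 : R) < n%:R by rewrite ltr0n.
have M0 : (0 : R) < M%:R by rewrite ltr0n ME; lia.
have Mn : M%:R <= n%:R :> R by rewrite ler_nat ME; lia.
have Ma : M%:R <= t%:R - a%:R :> R by rewrite -natrB 1?ltnW// ler_nat ME; lia.
have Mb : M%:R <= b%:R - t%:R :> R by rewrite -natrB 1?ltnW// ler_nat ME; lia.
have Mor : M%:R = t%:R - a%:R :> R \/ M%:R = b%:R - t%:R :> R.
  by rewrite -!natrB 1?ltnW// ME /minn; case: ifP; [left|right].
set D := `|jump mu k|; set T := threshold n q a t b.
have T0 : 0 <= T by exact: sqrtr_ge0.
have D0 : 0 <= D by exact: normr_ge0.
move=> /ltW; rewrite -(@ler_pXn2r _ 2) ?nnegrE ?mulr_ge0 ?sqrtr_ge0//; try lra.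
have q0 : 0 <= q by lra.
rewrite !exprMn (sqr_sqrtr (weight_ge0 _ _ _)) /T threshold_sqE// weightE//.
set w := _ / (b%:R - a%:R).
have wM : w <= M%:R.
  rewrite ler_pdivrMr; last by lra.
  by case: Mor => ->; [rewrite ler_pM2l|rewrite mulrC ler_pM2l]; lra.
have LT : level n%:R q M%:R <= threshold_sq n%:R q a%:R t%:R b%:R.
  case: Mor => ->; [exact: threshold_sq_ge_l|exact: threshold_sq_ge_r].
have Lq : q <= level n%:R q M%:R by apply: level_ge; lra.
have h1 : D ^+ 2 * w <= D ^+ 2 * M%:R by rewrite ler_wpM2l ?sqr_ge0.
have h2 : L * 1 * level n%:R q M%:R <= L ^+ 2 * threshold_sq n%:R q a%:R t%:R b%:R.
  have L0 : 0 <= L by clear -L1; lra.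
  apply: ler_pM => //; rewrite ?mulr1//; first exact: le_trans Lq.
  by rewrite expr2 ler_peMl//; clear -L1; lra.
move=> h3.
have : L * level n%:R q M%:R * (100 ^+ 2) <= D ^+ 2 * M%:R.
  have h4 := ler_wpM2l (_ : 0 <= (100 : R) ^+ 2) h2.
  rewrite mulr1 in h4; rewrite mulrC; apply: le_trans (h4 _) _; first exact: sqr_ge0.
  by rewrite mulrA; exact: le_trans h3 h1.
rewrite -ler_pdivlMr ?exprn_gt0//.
by rewrite exprVn mulrAC.
Qed.


(** By contradiction: if no point of [s] is closer than [d0], then [s] splits at [t]. Its neighbours
    there, possibly the sentinels 1 and [n.+1], are both farther than [m / 20] ([far_apart]), or the
    nearer one is not ([near_left], [near_right]); each case contradicts minimality. *)
Lemma minimizer_close n (theta e : 'rV[R]_n) (mu1 mu2 L q d0 : R) (t m : nat)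
    (s : seq nat) :
  100 <= q -> 100 <= L -> (0 < m)%N -> (m < t)%N -> (t + m <= n.+1)%N ->
  (forall l : 'I_n, (t - m <= l.+1 < t)%N -> theta 0 l = mu1) ->
  (forall l : 'I_n, (t <= l.+1 < t + m)%N -> theta 0 l = mu2) ->
  detectable n%:R q L m%:R `|mu2 - mu1| ->
  good_noise q e -> is_minimizer L q (theta + e) s ->
  (forall j, (t - m <= j <= t)%N -> d0 <= t%:R - j%:R ->
     `|psum e t%:R - psum e j%:R| <= `|mu2 - mu1| / 40 * (t%:R - j%:R)) ->
  (forall j, (t <= j <= t + m)%N -> d0 <= j%:R - t%:R ->
     `|psum e j%:R - psum e t%:R| <= `|mu2 - mu1| / 40 * (j%:R - t%:R)) ->
  0 < d0 -> exists2 u, u \in s & `|u%:R - t%:R| < d0.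
Proof.
move=> q1 L1 m0 mt tmn thl thr Mhe gn smin el er d00.
have q0 : 0 <= q by lra.
apply: contrapT => close.
have far u : u \in s -> d0 <= `|u%:R - t%:R|.
  by move=> us; rewrite leNgt; apply/negP => ud; apply: close; exists u.
have tns : t \notin s.
  by apply/negP => /far; rewrite subrr normr0; lra.
have [s1 [s2 [E h1 h2]]] := sorted_split (andP smin.1).1 tns.
rewrite {s tns close}E in smin far.
have ut : (last 1 s1 < t)%N.
  case/lastP: s1 h1 {smin far} => [|s1 x]; first by rewrite /=; nat_lia.
  by rewrite all_rcons last_rcons => /andP[].
have tv : (t < head n.+1 s2)%N.
  by case: s2 h2 {smin far} => [|x s2] /=; [nat_lia|case/andP].
pose G := grid n; pose T : R := t%:R; pose M : R := m%:R.
pose F := psum (theta + e); pose W := psum e.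
have Gn j : (1 <= j)%N -> (j <= n.+1)%N -> G j%:R by exists j => //; apply/andP.
have Tm : (t - m)%:R = T - M by rewrite natrB// ltnW.
have Tp : (t + m)%:R = T + M by rewrite natrD.
have hl : homog_left G F W T M mu1.
  move=> z [j j1n ->]; rewrite -Tm !ler_nat => jt.
  apply: psum_const; try nat_lia.
  by move=> l lj; apply: thl; nat_lia.
have hr : homog_right G F W T M mu2.
  move=> z [j j1n ->]; rewrite -Tp !ler_nat => jt.
  apply: psum_const; try nat_lia.
  by move=> l lj; apply: thr; nat_lia.
have noise lo hi : small_noise G W n%:R q lo hi.
  move=> _ _ _ [i hi' ->] [j hj ->] [k hk ->] _ ij jk _.
  rewrite !ltr_nat in ij jk; apply: good_noise_cusum_sq => //; nat_lia.
have wl z : G z -> d0 <= T - z <= M -> `|W T - W z| <= `|mu2 - mu1| / 40 * (T - z).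
  move=> [j j1n ->] /andP[d0j jM]; apply: el => //.
  have jt : (j%:R : R) < t%:R by rewrite -/T; lra.
  have tmj : ((t - m)%:R : R) <= j%:R by rewrite Tm; lra.
  by rewrite ltr_nat in jt; rewrite ler_nat in tmj; nat_lia.
have wr z : G z -> d0 <= z - T <= M -> `|W z - W T| <= `|mu2 - mu1| / 40 * (z - T).
  move=> [j j1n ->] /andP[d0j jM]; apply: er => //.
  have jt : (t%:R : R) < j%:R by rewrite -/T; lra.
  have tmj : (j%:R : R) <= (t + m)%:R by rewrite Tp; lra.
  by rewrite ltr_nat in jt; rewrite ler_nat in tmj; nat_lia.
have M0 : 0 < M by rewrite ltr0n.
have Mn : 2 * M <= n%:R.
  have -> : 2 * M = (m + m)%:R by rewrite natrD /M; ring.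
  by rewrite ler_nat; nat_lia.
have noins r1 r2 x : is_minimizer L q (theta + e) (r1 ++ r2) ->
    no_insertion F n%:R q L (last 1%N r1)%:R x%:R (head n.+1 r2)%:R.
  by move=> hmin; rewrite /no_insertion !ltr_nat; exact: minimizer_insert.
clear thl thr el er gn.
have [u1 _ _ vn] := cpv_gap (cpv_insert smin.1 ut tv).
have LD (i j : nat) : (i <= j)%N -> (j%:R - i%:R : R) = (j - i)%:R.
  by move=> ij; rewrite natrB.
have far_apart : (m < 20 * (t - last 1 s1))%N -> (m < 20 * (head n.+1 s2 - t))%N -> False.
  move=> hu hv.
  (* The neighbour itself if it is within [m] of [t], otherwise an auxiliary point at distance
     [m / 2] rounded up, hence positive even for [m = 1]. *)
  have [p [up pt pm hp hp']] : exists p, [/\ (last 1 s1 <= p)%N, (p < t)%N, (t - m <= p)%N,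
      (m <= 20 * (t - p))%N & (last 1 s1 < p)%N -> (m <= 20 * (p - last 1 s1))%N].
    have [um|um] := leqP (t - m)%N (last 1%N s1); first by exists (last 1%N s1); split; nat_lia.
    by exists (t - m.+1 %/ 2)%N; split; nat_lia.
  have [r [tr rv rm hr1 hr2]] : exists r, [/\ (t < r)%N, (r <= head n.+1 s2)%N,
      (r <= t + m)%N, (m <= 20 * (r - t))%N &
      (r < head n.+1 s2)%N -> (m <= 20 * (head n.+1 s2 - r))%N].
    have [um|um] := leqP (head n.+1 s2) (t + m)%N; first by exists (head n.+1 s2); split; nat_lia.
    by exists (t + (m.+1 %/ 2))%N; split; nat_lia.
  have thL (i j l : nat) : (i < j)%N -> (j < l)%N -> (m <= 20 * (j - i))%N ->
      (m <= 20 * (l - j))%N -> L * threshold_sq n%:R q i%:R j%:R l%:R <= 2 * (L * level n%:R q M).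
    move=> ij jl hij hjl; rewrite mulrCA ler_wpM2l//; first by clear -L1; lra.
    apply: threshold_sq_le_level; rewrite ?ltr_nat//; first by rewrite M0; clear -Mn M0; lra.
      by rewrite LD 1?ltnW// -natrM ler_nat.
    by rewrite LD 1?ltnW// -natrM ler_nat.
  have X0 : 0 <= 2 * (L * level n%:R q M).
    rewrite !mulr_ge0//; first by clear -L1; lra.
    by apply: le_trans q0 (level_ge _ _); rewrite M0; clear -Mn M0; lra.
  have := minimizer_insert3 smin X0 up pt tr rv
    (fun h => thL _ _ _ h (_ : (p < _)%N) (hp' h) (_ : (m <= _)%N))
    (fun h => thL _ _ _ (_ : (p < _)%N) h (_ : (m <= _)%N) (hr2 h)).
  move=> /(_ (ltac:(nat_lia)) (ltac:(nat_lia)) (ltac:(nat_lia)) (ltac:(nat_lia))) hA.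
  have pT : p%:R < T by rewrite ltr_nat.
  have Tr : T < r%:R by rewrite ltr_nat.
  have GT : G T by apply: Gn; nat_lia.
  have Gp : G p%:R by apply: Gn; nat_lia.
  have Gr : G r%:R by apply: Gn; nat_lia.
  have nz := noise _ _ _ _ _ Gp GT Gr (lexx _) pT Tr (lexx _).
  have e1 : T - M <= p%:R by rewrite -Tm ler_nat.
  have e2 : r%:R <= T + M by rewrite -Tp ler_nat.
  have e3 : M <= 20 * (T - p%:R) by rewrite LD 1?ltnW// -natrM ler_nat.
  have e4 : M <= 20 * (r%:R - T) by rewrite LD 1?ltnW// -natrM ler_nat.
  have := detection_energy M0 Mn q1 L1 GT Gp Gr hl hr nz Mhe pT Tr e1 e2 e3 e4.
  rewrite -/F -/T in hA; clear -hA; lra.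
have GT : G T by apply: Gn; nat_lia.
have GTm : G (T - M) by rewrite -Tm; apply: Gn; nat_lia.
have GTp : G (T + M) by rewrite -Tp; apply: Gn; nat_lia.
have M20 (i j c : nat) : (i <= j)%N -> (c%:R * (j%:R - i%:R : R) <= M) = (c * (j - i) <= m)%N.
  by move=> ij; rewrite LD// -natrM ler_nat.
have near_left : (20 * (t - last 1 s1) <= m)%N -> (t - last 1 s1 <= head n.+1 s2 - t)%N -> False.
  (* With [s1] empty the neighbour is the sentinel 1, at distance at least [m] from [t], which is
     not that close. The sentinels are excluded in the same way below. *)
  case/lastP: s1 {h1} smin far ut u1 {far_apart} => [|s0 u] smin far ut u1; first by rewrite /=; nat_lia.
  rewrite last_rcons => xm xy; rewrite last_rcons in ut u1.
  have [u'1 u'u _ _] : [/\ (1 <= last 1 s0)%N, (last 1 s0 < u)%N, true & true].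
    by move: smin => [cs _]; rewrite cat_rcons in cs; have [-> ->] := cpv_gap cs.
  have du : d0 <= T - u%:R.
    have := far u; rewrite mem_cat mem_rcons mem_head => /(_ isT).
    by rewrite distrC ger0_norm// subr_ge0 ler_nat ltnW.
  have smin' : is_minimizer L q (theta + e) (s0 ++ u :: s2) by rewrite -cat_rcons.
  apply: (@move_left_point_suboptimal R G F W n%:R q L T M mu1 mu2 d0 (last 1%N s0)%:R u%:R
    (head n.+1 s2)%:R) => //; rewrite ?ltr_nat//.
  - by apply: Gn; nat_lia.
  - by apply: Gn; nat_lia.
  - by apply: Gn; nat_lia.
  - by rewrite !LD 1?ltnW// ler_nat.
  - by rewrite M20// ltnW.
  - by rewrite -Tm; have := noins _ _ (t - m)%N smin'.
  - by rewrite -Tp; have := noins _ _ (t + m)%N smin; rewrite last_rcons.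
  - case/lastP: s0 smin' u'u u'1 {smin far} => [|s0 u'] smin' u'u u'1; first by rewrite /= M20; nat_lia.
    rewrite last_rcons in u'u u'1 *; rewrite cat_rcons in smin' => _.
    have [u''1 u''u' _ _] := cpv_gap smin'.1.
    exists (last 1%N s0)%:R; split; [by apply: Gn; nat_lia|by rewrite ltr_nat| |].
      by rewrite -Tm; have := noins _ _ (t - m)%N smin'.
    exact: (minimizer_remove smin').
  - exact: minimizer_move_right.
  - case: s2 h2 smin smin' tv vn xy {far} => [|v s3] h2 smin smin' tv vn xy; first by rewrite /= M20; nat_lia.
    rewrite /= in tv vn xy * => _.
    have smin2 : is_minimizer L q (theta + e) (rcons s0 u ++ v :: s3) by [].
    have [_ _ vv' v'n] := cpv_gap smin2.1.
    exists (head n.+1 s3)%:R; split; [by apply: Gn; nat_lia|by rewrite ltr_nat| |].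
      rewrite -Tp; have := noins (rcons (rcons s0 u) v) s3 (t + m)%N.
      by rewrite last_rcons cat_rcons; apply.
    exact: (minimizer_merge smin').
have near_right : (20 * (head n.+1 s2 - t) <= m)%N -> (head n.+1 s2 - t <= t - last 1 s1)%N -> False.
  case: s2 {h2} smin far tv vn {far_apart near_left} => [|v s3] smin far tv vn; first by rewrite /=; nat_lia.
  rewrite /= in tv vn * => ym xy.
  have [_ _ vv' v'n] := cpv_gap smin.1.
  have dv : d0 <= v%:R - T.
    have := far v; rewrite mem_cat mem_head orbT => /(_ isT).
    by rewrite ger0_norm// subr_ge0 ler_nat ltnW.
  apply: (@move_right_point_suboptimal R G F W n%:R q L T M mu1 mu2 d0 (last 1%N s1)%:R v%:R
    (head n.+1 s3)%:R) => //; rewrite ?ltr_nat//.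
  - by apply: Gn; nat_lia.
  - by apply: Gn; nat_lia.
  - by apply: Gn; nat_lia.
  - by rewrite !LD 1?ltnW// ler_nat.
  - by rewrite M20// ltnW.
  - rewrite -Tp; have := noins (rcons s1 v) s3 (t + m)%N.
    by rewrite last_rcons cat_rcons; apply.
  - by rewrite -Tm; have := noins _ _ (t - m)%N smin.
  - case: s3 smin vv' v'n {far} => [|v' s3] smin vv' v'n; first by rewrite /= M20; nat_lia.
    rewrite /= in vv' v'n * => _.
    have smin2 : is_minimizer L q (theta + e) (rcons s1 v ++ v' :: s3) by rewrite cat_rcons.
    have [_ _ v'v'' v''n] := cpv_gap smin2.1.
    exists (head n.+1 s3)%:R; split; [by apply: Gn; nat_lia|by rewrite ltr_nat| |].
      rewrite -Tp; have := noins (rcons (rcons s1 v) v') s3 (t + m)%N.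
      by rewrite last_rcons !cat_rcons; apply.
    by have := minimizer_remove smin2; rewrite last_rcons.
  - exact: minimizer_move_left.
  - case/lastP: s1 h1 smin ut u1 xy {far} => [|s0 u] h1 smin ut u1 xy; first by rewrite /= M20; nat_lia.
    rewrite last_rcons in ut u1 xy *; rewrite cat_rcons in smin => _.
    have [u'1 u'u _ _] := cpv_gap smin.1.
    exists (last 1%N s0)%:R; split; [by apply: Gn; nat_lia|by rewrite ltr_nat| |].
      by rewrite -Tm; have := noins _ _ (t - m)%N smin.
    exact: (minimizer_merge smin).
(* If some neighbour is within [m / 20], so is the nearer of the two. *)
have [c1|c1] := leqP (20 * (t - last 1 s1))%N m; have [c2|c2] := leqP (20 * (head n.+1 s2 - t))%N m;
have [c3|c3] := leqP (t - last 1 s1)%N (head n.+1 s2 - t)%N.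
all: try by apply: near_left.
all: try by apply: near_right => //; exact: ltnW.
all: try by apply: far_apart.
all: nat_lia.
Qed.

(** [minimizer_close] with [m] the distance to the nearest of the two adjacent change-points, the
    signal being constant at least that far on each side. *)
Lemma localization n (theta e : 'rV[R]_n) (taus : seq nat) (mu : nat -> R)
    (k : nat) (L q d0 : R) (s : seq nat) :
  100 <= q -> 100 <= L ->
  describes theta taus mu -> (1 <= k <= size taus)%N ->
  high_energy n (100 * L) q taus mu k -> good_noise q e ->
  is_minimizer L q (theta + e) s ->
  (forall j, (cp n taus k.-1 <= j <= cp n taus k)%N -> d0 <= (cp n taus k)%:R - j%:R ->
     `|psum e (cp n taus k)%:R - psum e j%:R| <=
     `|jump mu k| / 40 * ((cp n taus k)%:R - j%:R)) ->
  (forall j, (cp n taus k <= j <= cp n taus k.+1)%N -> d0 <= j%:R - (cp n taus k)%:R ->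
     `|psum e j%:R - psum e (cp n taus k)%:R| <=
     `|jump mu k| / 40 * (j%:R - (cp n taus k)%:R)) ->
  0 < d0 -> exists2 u, u \in s & `|u%:R - (cp n taus k)%:R| < d0.
Proof.
move=> q1 L1 [ctaus muk thetaE] /andP[k1 ks] he gn smin el er d00.
have n0 : (0 < n)%N.
  have s0 : (0 < size taus)%N by nat_lia.
  by case/andP: (ctaus) => _ /allP /(_ _ (mem_nth 0%N s0)) /andP[]; nat_lia.
have Mhe := high_energy_min q1 L1 n0 ctaus (introT andP (conj k1 ks)) he erefl.
have cb := cp_lt n0 ctaus ks.
have := @cp_lt n taus k.-1 n0 ctaus; rewrite prednK// => /(_ (leq_trans (leq_pred k) ks)) ca.
have := @cp_le n taus 0 k.-1 n0 ctaus; rewrite leq0n /= => /(_ (ltac:(nat_lia))) a1.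
have := @cp_le n taus k.+1 (size taus).+1 n0 ctaus; rewrite [cp n taus (size taus).+1]nth_default//.
move=> /(_ (ltac:(nat_lia))) bn.
have thl (l : 'I_n) : (cp n taus k.-1 <= l.+1 < cp n taus k)%N -> theta 0 l = mu k.
  move=> hl; apply: thetaE; first by rewrite k1 /= ltnW.
  by rewrite /in_seg prednK.
have thr (l : 'I_n) : (cp n taus k <= l.+1 < cp n taus k.+1)%N -> theta 0 l = mu k.+1.
  by move=> hl; apply: thetaE.
clear he thetaE muk ctaus ks.
rewrite /jump in el er Mhe *.
move: (mu k) (mu k.+1) thl thr el er Mhe => mu1 mu2 thl thr el er Mhe.
move: (cp n taus k) (cp n taus k.-1) (cp n taus k.+1) ca cb a1 bn thl thr el er Mhe
  => t a b ca cb a1 bn thl thr el er.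
set m := minn _ _ => Mhe.
have [ma mb m0] : [/\ (m <= t - a)%N, (m <= b - t)%N & (0 < m)%N] by rewrite /m; split; nat_lia.
have {}a1 : (1 <= a)%N by exact: a1.
have [mt tm] : (m < t)%N /\ (t + m <= n.+1)%N.
  by clearbody m; split; nat_lia.
apply: (minimizer_close q1 L1 m0 mt tm _ _ Mhe gn smin _ _ d00); clearbody m.
- by move=> l lj; apply: thl; nat_lia.
- by move=> l lj; apply: thr; nat_lia.
- by move=> j hj; apply: el; nat_lia.
- by move=> j hj; apply: er; nat_lia.
Qed.

End Localization.

(** * Noise around the change-point, measurability, and the probability bound *)

Section Main.
Local Open Scope classical_set_scope.
Context (R : realType).

Lemma psum_next n (e : 'rV[R]_n) (l : 'I_n) :
  psum e l.+2%:R = psum e l.+1%:R + e 0 l.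
Proof.
apply/eqP; rewrite addrC -subr_eq; apply/eqP.
rewrite -psumB// (big_pred1 l)// => i.
by rewrite /= -val_eqE /=; lia.
Qed.

Lemma psum_forward n (e : 'rV[R]_n) (i0 : 'I_n) (t d : nat) :
  (1 <= t)%N -> (t + d <= n.+1)%N ->
  psum e (t + d)%:R - psum e t%:R = \sum_(i < d) e 0 (insubd i0 (t.-1 + i)%N).
Proof.
move=> t1; elim: d => [|d IH] tdn; first by rewrite addn0 big_ord0 subrr.
rewrite big_ord_recr /= -IH; last by lia.
have ln : (t.-1 + d < n)%N by lia.
have E : (insubd i0 (t.-1 + d)%N : 'I_n) = Ordinal ln.
  by apply/val_inj; rewrite val_insubd ln.
rewrite E; have := psum_next e (Ordinal ln); rewrite /=.
have -> : (t.-1 + d).+2 = (t + d.+1)%N by lia.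
have -> : (t.-1 + d).+1 = (t + d)%N by lia.
by move=> ->; ring.
Qed.

(** The noise is enumerated away from [t], so that intervals ending at [t] become initial partial
    sums. Position [t - 1 - i] has index [t - i.+2]; the default [i0] is never reached. *)
Lemma psum_backward n (e : 'rV[R]_n) (i0 : 'I_n) (t d : nat) :
  (d < t)%N -> (t <= n.+1)%N ->
  psum e t%:R - psum e (t - d)%:R = \sum_(i < d) e 0 (insubd i0 (t - i.+2)%N).
Proof.
move=> + tn; elim: d => [|d IH] dt; first by rewrite subn0 big_ord0 subrr.
rewrite big_ord_recr /= -IH; last by lia.
have ln : (t - d.+2 < n)%N by lia.
have E : (insubd i0 (t - d.+2)%N : 'I_n) = Ordinal ln.
  by apply/val_inj; rewrite val_insubd ln.
rewrite E; have := psum_next e (Ordinal ln); rewrite /=.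
have -> : (t - d.+2).+2 = (t - d)%N by lia.
have -> : (t - d.+2).+1 = (t - d.+1)%N by lia.
by move=> ->; ring.
Qed.

Lemma dH1_le (s : seq nat) (u t : nat) : u \in s ->
  (dH1 R s t <= `|u%:R - t%:R : R|%:E)%E.
Proof.
elim: s => // v s IH; rewrite inE /dH1 big_cons => /predU1P[->|/IH us].
  by rewrite ge_min lexx.
by rewrite ge_min us orbT.
Qed.

Lemma measurable_cusum d (T : measurableType d) (P : probability T R) n
    (eps : 'I_n -> {RV P >-> R}) (t1 t2 t3 : nat) :
  measurable_fun setT (fun w => cusum (noise_vec eps w) t1 t2 t3).
Proof.
have mm a b : measurable_fun setT (fun w => mean_on (noise_vec eps w) a b).
  rewrite /mean_on; apply: measurable_funM; last exact: measurable_cst.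
  under eq_fun => w do under eq_bigr => i _ do rewrite mxE.
  under eq_fun => w do rewrite -big_filter.
  exact: measurable_sum.
by apply: measurable_funM; [exact: measurable_funB|exact: measurable_cst].
Qed.

Lemma measurable_good_noise d (T : measurableType d) (P : probability T R) n
    (eps : 'I_n -> {RV P >-> R}) (q : R) :
  measurable [set w | good_noise q (noise_vec eps w)].
Proof.
pose A (t1 t2 t3 : nat) : set T :=
  if [&& 1 <= t1, t1 < t2, t2 < t3 & t3 <= n.+1]%N then
    [set w | `|cusum (noise_vec eps w) t1 t2 t3| <= 2 * threshold n q t1 t2 t3]
  else setT.
rewrite (_ : [set w | _] = \bigcap_t1 \bigcap_t2 \bigcap_t3 A t1 t2 t3).
  apply: bigcapT_measurable => t1; apply: bigcapT_measurable => t2.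
  apply: bigcapT_measurable => t3; rewrite /A; case: ifP => // _.
  rewrite -[X in measurable X]setTI; apply: measurable_fun_le => //.
  by apply: measurableT_comp => //; exact: measurable_cusum.
apply/seteqP; split=> w.
  move=> gn t1 _ t2 _ t3 _; rewrite /A; case: ifP => // /and4P[h1 h2 h3 h4].
  exact: gn.
move=> hA t1 t2 t3 h1 h2 h3 h4; have := hA t1 I t2 I t3 I.
by rewrite /A h1 h2 h3 h4.
Qed.

(** Sequences of naturals are countable, so the event is a countable union of events on which the
    estimator is fixed. *)
Lemma measurable_preimage_seq d (T : measurableType d) (tauhat : T -> seq nat)
    (B : set (seq nat)) :
  (forall s, measurable [set w | tauhat w = s]) ->
  measurable [set w | B (tauhat w)].
Proof.
move=> mt; have : exists (f : nat -> option (seq nat)) g, forall s, f (g s) = Some s.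
  by exists unpickle, pickle; exact: pickleK.
move=> [f [g gK]]; rewrite (_ : [set w | _] = \bigcup_k
    (if f k is Some s then [set w | tauhat w = s /\ B s] else set0)).
  apply: bigcupT_measurable => k; case: (f k) => [s|]; last exact: measurable0.
  have [Bs|nBs] := pselect (B s).
    rewrite (_ : [set w | _] = [set w | tauhat w = s])//.
    by apply/seteqP; split=> w /=; [case|].
  by rewrite (_ : [set w | _] = set0)// -subset0 => w /= [].
apply/seteqP; split=> w /=.
  by move=> Bw; exists (g (tauhat w)) => //; rewrite gK.
by move=> [k _]; case: (f k) => [s|] //= [->].
Qed.

(** Outside the crossing event [r * S < x + dd * (r ^+ 2 / 2)], and the lower bound on [dd] makes
    the first term at most the second. *)
Lemma drift_le (x r S dd : R) : 0 < r -> 2 * x / r ^+ 2 <= dd ->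
  ~ (x <= r * S - dd * (r ^+ 2 / 2)) -> S <= r * dd.
Proof.
move=> r0 hd nx; rewrite leNgt; apply/negP => hS; apply: nx.
move: hd; rewrite ler_pdivrMr ?exprn_gt0// => hd.
have h : r * (r * dd) <= r * S by rewrite ler_pM2l// ltW.
have -> : dd * (r ^+ 2 / 2) = dd * r ^+ 2 / 2 by rewrite mulrA.
have E : r * (r * dd) = dd * r ^+ 2 by ring.
rewrite E in h; lra.
Qed.

(** The maximal inequality with the parameters [r] and [- r] controls the two signs, whence the
    factor 2. *)
Lemma noise_mean_small d (T : measurableType d) (P : probability T R) n
    (eps : 'I_n -> {RV P >-> R}) (r x : R) (s : nat -> 'I_n) (m : nat) :
  subgaussian_noise eps -> 0 < r ->
  (forall i j, (i < m)%N -> (j < m)%N -> s i = s j -> i = j) ->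
  exists A : set T, [/\ measurable A, (P A <= (2 * expR (- x))%:E)%E &
    forall (k : nat) (w : T), ~ A w -> (k <= m)%N -> 2 * x / r ^+ 2 <= k%:R ->
      `|\sum_(i < k) noise_vec eps w 0 (s i)| <= r * k%:R].
Proof.
move=> sg r0 sinj.
have [A [mA PA hA]] := subgaussian_maximal r x sg sinj.
have [B [mB PB hB]] := subgaussian_maximal (- r) x sg sinj.
exists (A `|` B); split; first exact: measurableU.
  apply: le_trans (measureU2 _ mA mB) _.
  by rewrite mulr_natl mulr2n EFinD leeD.
move=> k w /not_orP[nA nB] km hk.
rewrite (eq_bigr (fun i : 'I_k => eps (s i) w)); last by move=> i _; rewrite mxE.
rewrite ler_norml; apply/andP; split; last first.
  by apply: (drift_le r0 hk) => h; apply: nA; exact: hA h.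
rewrite lerNl; apply: (drift_le r0 hk) => h; apply: nB; apply: (hB k) => //.
by rewrite mulrN -mulNr in h; rewrite sqrrN.
Qed.

End Main.

Theorem proposition8 (R : realType) :
  exists L0 q0 c c' : R,
    [/\ 0 < L0, 0 < q0, 0 < c & 0 < c'] /\
    forall L : R, L0 <= L ->
    exists kappa : R, 0 < kappa /\
    forall q : R, q0 < q ->
    forall (n : nat) (d : measure_display) (T : measurableType d)
      (P : probability T R) (eps : 'I_n -> {RV P >-> R}),
    subgaussian_noise eps ->
    forall (theta : 'rV[R]_n) (taus : seq nat) (mu : nat -> R) (k : nat),
    describes theta taus mu ->
    (1 <= k <= size taus)%N ->
    high_energy n kappa q taus mu k ->
    forall tauhat : T -> seq nat,
    (forall s : seq nat, measurable [set w | tauhat w = s]%classic) ->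
    (forall w : T, is_minimizer L q (theta + noise_vec eps w) (tauhat w)) ->
    forall x : R, 1 <= x ->
    (P [set w | (c * x * jump mu k ^- 2)%:E <=
                dH1 R (tauhat w) (cp n taus k) *
                (\1_[set w' | good_noise q (noise_vec eps w')] w)%:E]%classic
     <= (c' * expR (- x))%:E)%E.
Proof.
(* The third constant makes [d0] equal to [2 * x / r ^+ 2] with [r] the absolute jump divided by 40;
   the last one counts two sides of the change-point and two signs. *)
exists 100, 100, (2 * 40 ^+ 2), 4; split.
  by split; rewrite ?mulr_gt0 ?exprn_gt0//.
move=> L L1; exists (100 * L); split; first by lra.
move=> q q1 n d T P eps sg theta taus mu k dsc k1 he tauhat mt hmin x x1.
have [ctaus muk _] := dsc.
set t := cp n taus k; set c := 2 * 40 ^+ 2; set D := jump mu k.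
have D0 : 0 < `|D| by rewrite normr_gt0 subr_eq0; apply/eqP => E; exact: (muk k k1).
pose r := `|D| / 40; have r0 : 0 < r by rewrite divr_gt0.
pose d0 := c * x * D ^- 2.
have d0E : d0 = 2 * x / r ^+ 2.
  have Dn0 : D != 0 by rewrite -normr_gt0.
  by rewrite /d0 /c /r exprMn real_normK ?num_real//; field.
have d00 : 0 < d0 by rewrite d0E divr_gt0 ?exprn_gt0// mulr_gt0//; lra.
have n0 : (0 < n)%N.
  have s0 : (0 < size taus)%N by case/andP: k1 => h1 h2; exact: leq_trans h2.
  by case/andP: ctaus => _ /allP /(_ _ (mem_nth 0%N s0)) /andP[]; nat_lia.
pose i0 := Ordinal n0.
have /andP[k1' ks] := k1.
have cb : (t < cp n taus k.+1)%N := cp_lt n0 ctaus ks.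
have := @cp_lt n taus k.-1 n0 ctaus; rewrite prednK// -/t => /(_ (leq_trans (leq_pred k) ks)) ca.
have a1 : (1 <= cp n taus k.-1)%N by apply: (@cp_le n taus 0 k.-1 n0 ctaus); nat_lia.
have bn : (cp n taus k.+1 <= n.+1)%N.
  have := @cp_le n taus k.+1 (size taus).+1 n0 ctaus.
  by rewrite [cp n taus (size taus).+1]nth_default//; apply; nat_lia.
pose sr (i : nat) : 'I_n := insubd i0 (t.-1 + i)%N.
pose sl (i : nat) : 'I_n := insubd i0 (t - i.+2)%N.
have srinj i j : (i < cp n taus k.+1 - t)%N -> (j < cp n taus k.+1 - t)%N ->
    sr i = sr j -> i = j.
  move=> hi hj /(congr1 val); rewrite !val_insubd !ifT; nat_lia.
have slinj i j : (i < t - cp n taus k.-1)%N -> (j < t - cp n taus k.-1)%N ->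
    sl i = sl j -> i = j.
  move=> hi hj /(congr1 val); rewrite !val_insubd !ifT; nat_lia.
have [A [mA PA hA]] := noise_mean_small x sg r0 srinj.
have [B [mB PB hB]] := noise_mean_small x sg r0 slinj.
set E := [set w | _]%classic.
(* Since [d0] is positive the indicator cannot vanish, even when the distance is infinite, because
   [+oo * 0 = 0]. *)
have dist_le w : E w -> good_noise q (noise_vec eps w) /\
    (d0%:E <= dH1 R (tauhat w) t)%E.
  rewrite /E /= indicE; case: (boolP (w \in _)) => [|_].
    by rewrite inE /= mule1.
  by rewrite mule0 lee_fin -/d0 leNgt d00.
have mE : measurable E.
  rewrite (_ : E = ([set w | good_noise q (noise_vec eps w)] `&`
     [set w | (d0%:E <= dH1 R (tauhat w) t)%E])%classic).
    apply: measurableI; first exact: measurable_good_noise.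
    exact: (measurable_preimage_seq (fun s => (d0%:E <= dH1 R s t)%E : Prop)).
  apply/seteqP; split=> w; first exact: dist_le.
  by move=> [/= gn dw]; rewrite /E /= indicE mem_set// mule1.
(* Outside [A] and [B], the means of the noise on both sides are small, and [localization] yields an
   estimated point at distance less than [d0]. *)
have sub : (E `<=` A `|` B)%classic.
  move=> w Ew; apply: contrapT => /not_orP[nA nB].
  have [gn dw] := dist_le _ Ew.
  have hl j : (cp n taus k.-1 <= j <= t)%N -> d0 <= t%:R - j%:R ->
      `|psum (noise_vec eps w) t%:R - psum (noise_vec eps w) j%:R| <=
      `|D| / 40 * (t%:R - j%:R).
    move=> /andP[aj jt]; rewrite -natrB// d0E => hd.
    have [tj tn] : (t - j < t)%N /\ (t <= n.+1)%N by split; nat_lia.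
    have := psum_backward (noise_vec eps w) i0 tj tn; rewrite subKn// => ->.
    by apply: hB => //; nat_lia.
  have hr j : (t <= j <= cp n taus k.+1)%N -> d0 <= j%:R - t%:R ->
      `|psum (noise_vec eps w) j%:R - psum (noise_vec eps w) t%:R| <=
      `|D| / 40 * (j%:R - t%:R).
    move=> /andP[tj jb]; rewrite -natrB// d0E => hd.
    have [t1 tn] : (1 <= t)%N /\ (t + (j - t) <= n.+1)%N by split; nat_lia.
    have := psum_forward (noise_vec eps w) i0 t1 tn; rewrite subnKC// => ->.
    by apply: hA => //; nat_lia.
  have [u us ud] := localization (ltW q1) L1 dsc k1 he gn (hmin w) hl hr d00.
  have := le_trans dw (dH1_le R t us); rewrite lee_fin -/t in ud *.
  by rewrite leNgt ud.
apply: le_trans (_ : P (A `|` B)%classic <= _)%E.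
  by apply: le_measure; rewrite ?inE//; exact: measurableU.
apply: le_trans (measureU2 _ mA mB) _.
apply: le_trans (leeD PA PB) _.
by rewrite -EFinD lee_fin; lra.
Qed.
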